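(* Let $T>0$, $n,k,m\ge 1$, $0=t_0<t_1<\dots<t_m=T$, let $A,\varphi_j,\psi_j$ ($j=1,\dots,k$) be continuous $(n\times n)$-matrix functions on $[0,T]$, let $B_0,\dots,B_m$ be constant $(n\times n)$ matrices, and let $\Delta_m$ denote the partition $[0,T)=\bigcup_{r=1}^m[t_{r-1},t_r)$. Suppose that $\Delta_m$ is regular, i.e. the $(nk\times nk)$ matrix $I-G(\Delta_m)$ is invertible, and that the $(nm\times nm)$ matrix $Q_\ast(\Delta_m)$ is invertible (both matrices are defined in the context). Then for every $f\in C([0,T],\mathbb R^n)$ and $d\in\mathbb R^n$ the problem $$\frac{dx}{dt}=A(t)x+\sum_{j=1}^k\int_0^T\varphi_j(t)\psi_j(\tau)x(\tau)\,d\tau+f(t),\quad t\in(0,T),\qquad \sum_{i=0}^m B_i x(t_i)=d,$$ has a unique solution $x^\ast$, and $$\|x^\ast\|_1\le \mathcal N(k,\Delta_m)\max(\|d\|,\|f\|_1),$$ where, writing $\rho=\|[I-G(\Delta_m)]^{-1}\|$ and $\gamma_\ast(\Delta_m)=\|[Q_\ast(\Delta_m)]^{-1}\|$, $$\mathcal N(k,\Delta_m)=e^{\alpha\overline\omega}\Big\{\overline\varphi(k)\Big[\rho\,\overline\psi(T)\big(e^{\alpha\overline\omega}-1+e^{\alpha\overline\omega}\,\overline\varphi(k)\,\overline\psi(T)\big)+\overline\psi(T)\Big]+1\Big\}\,\gamma_\ast(\Delta_m)\,(1+\|B_m\|)$$ $$\times\max\Big\{1,\ \overline\omega e^{\alp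ha\overline\omega}\big[1+e^{\alpha\overline\omega}\,\overline\varphi(k)\,\rho\,\overline\psi(T)\big]\Big\}+e^{\alpha\overline\omega}\,\overline\omega\big[\overline\varphi(k)\,\rho\,\overline\psi(T)\,e^{\alpha\overline\omega}+1\big].$$
   Context: Norms: $\|x\|=\max_i|x_i|$ for vectors (in $\mathbb R^n$, $\mathbb R^{nk}$, $\mathbb R^{nm}$), matrices carry the induced operator norm, and $\|x\|_1=\max_{t\in[0,T]}\|x(t)\|$ for $x\in C([0,T],\mathbb R^n)$. A solution of the problem is a function $x:[0,T]\to\mathbb R^n$ that is continuous on $[0,T]$, continuously differentiable on $(0,T)$, and satisfies the integro-differential equation on $(0,T)$ and the multipoint condition. For $r=1,\dots,m$ let $X_r(t)$ be a fundamental matrix of $dx/dt=A(t)x$ on $[t_{r-1},t_r]$ (the quantities below do not depend on its choice). Matrix $G(\Delta_m)=(G_{p,l}(\Delta_m))_{p,l=1}^k$, with $(n\times n)$ blocks $$G_{p,l}(\Delta_m)=\sum_{r=1}^m\int_{t_{r-1}}^{t_r}\psi_p(\tau)X_r(\tau)\int_{t_{r-1}}^{\tau}X_r^{-1}(\tau_1)\varphi_l(\tau_1)\,d\tau_1\,d\tau .$$ When $I-G(\Delta_m)$ is invertible, write $[I-G(\Delta_m)]^{-1}=(M_{j,p}(\Delta_m))_{j,p=1}^k$ with $(n\times n)$ blocks. For $p=1,\dots,k$, $r=1,\dots,m$: $$V_{p,r}(\Delta_m)=\int_{t_{r-1}}^{t_r}\psi_p(\tau)X_r(\tau)\int_{t_{r-1}}^{\tau}X_r^{-1}(\tau_1)A(\tau_1)\,d\tau_1\,d\tau+\sum_{s=1}^m\sum_{j=1}^k\int_{t_{s-1}}^{t_s}\psi_p(\tau)X_s(\tau)\int_{t_{s-1}}^{\tau}X_s^{-1}(\tau_1)\varphi_j(\tau_1)\,d\tau_1\,d\tau\int_{t_{r-1}}^{t_r}\psi_j(\tau_2)\,d\tau_2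 .$$ For $r,i=1,\dots,m$ (with $\delta_{ri}$ the Kronecker symbol): $$D_{r,i}(\Delta_m)=\sum_{j=1}^kX_r(t_r)\int_{t_{r-1}}^{t_r}X_r^{-1}(\tau)\varphi_j(\tau)\,d\tau\Big[\sum_{p=1}^kM_{j,p}(\Delta_m)V_{p,i}(\Delta_m)+\int_{t_{i-1}}^{t_i}\psi_j(\tau_1)\,d\tau_1\Big]+\delta_{ri}X_r(t_r)\int_{t_{r-1}}^{t_r}X_r^{-1}(\tau)A(\tau)\,d\tau .$$ $Q_\ast(\Delta_m)$ is the $(nm\times nm)$ matrix of the linear map sending $\lambda=(\lambda_1,\dots,\lambda_m)\in\mathbb R^{nm}$ ($\lambda_r\in\mathbb R^n$) to the vector whose first $\mathbb R^n$-component is $$\sum_{i=0}^{m-2}[B_i+B_mD_{m,i+1}(\Delta_m)]\lambda_{i+1}+[B_{m-1}+B_m+B_mD_{m,m}(\Delta_m)]\lambda_m$$ and whose $(p+1)$-th component, $p=1,\dots,m-1$, is $$[I+D_{p,p}(\Delta_m)]\lambda_p-[I-D_{p,p+1}(\Delta_m)]\lambda_{p+1}+\sum_{i\ne p,\,i\neq p+1}D_{p,i}(\Delta_m)\lambda_i .$$ Constants: $\alpha=\max_{t\in[0,T]}\|A(t)\|$, $\overline\omega=\max_{r}(t_r-t_{r-1})$, $\overline\varphi(k)=\max_{r=1,\dots,m}\int_{t_{r-1}}^{t_r}\sum_{j=1}^k\|\varphi_j(t)\|\,dt$, $\overline\psi(T)=\max_{p=1,\dots,k}\int_0^T\|\psi_p(t)\|\,dt$.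 *)

(* Defs.v *)
From HB Require Import structures.
From mathcomp Require Import all_boot all_order all_algebra.
From mathcomp Require Import all_classical all_reals all_analysis.

Set Implicit Arguments.
Unset Strict Implicit.
Unset Printing Implicit Defensive.

Import Order.TTheory GRing.Theory Num.Theory.
Import numFieldNormedType.Exports.

Local Open Scope classical_set_scope.
Local Open Scope ring_scope.

Section MatrixAnalysis.
Variable R : realType.

(* On column vectors the library norm `|x| is the max norm.  On matrices it is
   the largest |entry|, which is not the operator norm induced by `|x|. *)
Definition opnorm (p q : nat) (M : 'M[R]_(p, q)) : R :=
  sup [set `|M *m x| | x in [set x : 'cV[R]_q | `|x| <= 1]].

Definition mxint (p q : nat) (a b : R) (F : R -> 'M[R]_(p, q)) : 'M[R]_(p, q) :=
  \matrix_(i < p, j < q)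
    (\int[lebesgue_measure]_(s in `[a, b]) (F s i j))%R.

(* The supremum is a maximum when f is continuous on [0, T]. *)
Definition norm1 (n : nat) (T : R) (f : R -> 'cV[R]_n) : R :=
  sup [set `|f s| | s in `[0, T]].

Definition fundamental_matrix (n : nat) (A : R -> 'M[R]_n) (a b : R)
    (X : R -> 'M[R]_n) : Prop :=
  [/\ {within `[a, b], continuous X},
      forall s : R, s \in `]a, b[ -> is_derive s 1 X (A s *m X s)
    & forall s : R, s \in `[a, b] -> X s \in unitmx].

End MatrixAnalysis.

(* The partition is 0 = t 0 < ... < t m = T.  Subintervals are numbered from 0:
   index r < m stands for [t r, t r.+1], i.e. for the index r + 1 of the
   mathematical notation, and likewise for X, Vmx, Dmx and the blocks of Qstar.
   Values of t and B beyond m, and of X beyond m - 1, are irrelevant. *)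
Section Problem.
Variables (R : realType) (n k m : nat) (T : R) (t : nat -> R).
Variables (A : R -> 'M[R]_n) (phi psi : 'I_k -> R -> 'M[R]_n).
Variable B : nat -> 'M[R]_n.

Definition is_solution (f : R -> 'cV[R]_n) (d : 'cV[R]_n)
    (x : R -> 'cV[R]_n) : Prop :=
  [/\ {within `[0, T], continuous x},
      (forall s : R, s \in `]0, T[ -> derivable x s 1),
      {within `]0, T[, continuous (derive1 x)},
      (forall s : R, s \in `]0, T[ ->
         derive1 x s = A s *m x s
           + \sum_(j < k) mxint 0 T (fun tau => phi j s *m psi j tau *m x tau)
           + f s)
    & \sum_(0 <= i < m.+1) B i *m x (t i) = d].

Variable X : nat -> R -> 'M[R]_n.

(* X_r(tau) int_{t_r}^tau X_r^{-1}(tau1) F(tau1) dtau1 *)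
Definition propagate (r : nat) (F : R -> 'M[R]_n) (tau : R) : 'M[R]_n :=
  X r tau *m mxint (t r) tau (fun tau1 => invmx (X r tau1) *m F tau1).

Definition Gblock (p l : 'I_k) : 'M[R]_n :=
  \sum_(r < m) mxint (t r) (t r.+1)
    (fun tau => psi p tau *m propagate r (phi l) tau).

Definition Gmx : 'M[R]_(\sum_(p < k) n) := \mxblock_(p < k, l < k) Gblock p l.

Definition IG : 'M[R]_(\sum_(p < k) n) := 1%:M - Gmx.

Definition Mblock (j p : 'I_k) : 'M[R]_n := submxblock (invmx IG) j p.

Definition Vmx (p : 'I_k) (r : nat) : 'M[R]_n :=
  mxint (t r) (t r.+1) (fun tau => psi p tau *m propagate r A tau)
  + \sum_(s < m) \sum_(j < k)
      mxint (t s) (t s.+1) (fun tau => psi p tau *m propagate s (phi j) tau)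
      *m mxint (t r) (t r.+1) (psi j).

Definition Dmx (r i : nat) : 'M[R]_n :=
  \sum_(j < k) propagate r (phi j) (t r.+1)
    *m (\sum_(p < k) Mblock j p *m Vmx p i + mxint (t i) (t i.+1) (psi j))
  + (if r == i then propagate r A (t r.+1) else 0).

(* Row 0 is the multipoint condition; row p > 0 is the continuity condition at
   the interior point t p, which involves Dmx at the 0-based row p - 1. *)
Definition Qblock (p i : nat) : 'M[R]_n :=
  if p == 0%N then
    if i == m.-1 then B m.-1 + B m + B m *m Dmx m.-1 m.-1
    else B i + B m *m Dmx m.-1 i
  else
    if i == p.-1 then 1%:M + Dmx p.-1 p.-1
    else if i == p then - (1%:M - Dmx p.-1 p)
    else Dmx p.-1 i.

Definition Qstar : 'M[R]_(\sum_(p < m) n) := \mxblock_(p < m, i < m) Qblock p i.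

Definition alpha : R := sup [set opnorm (A s) | s in `[0, T]].

(* The maxima below are over nonempty families of nonnegative numbers, so the
   default value 0 is harmless. *)
Definition omega_bar : R := \big[Num.max/0]_(r < m) (t r.+1 - t r).

Definition phi_bar : R :=
  \big[Num.max/0]_(r < m)
    (\int[lebesgue_measure]_(s in `[t r, t r.+1])
       (\sum_(j < k) opnorm (phi j s)))%R.

Definition psi_bar : R :=
  \big[Num.max/0]_(p < k)
    (\int[lebesgue_measure]_(s in `[0, T]) (opnorm (psi p s)))%R.

Definition rho : R := opnorm (invmx IG).

Definition gamma_star : R := opnorm (invmx Qstar).

Definition Nconst : R :=
  let e := expR (alpha * omega_bar) in
  e * (phi_bar * (rho * psi_bar * (e - 1 + e * phi_bar * psi_bar) + psi_bar) + 1)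
    * gamma_star * (1 + opnorm (B m))
    * Num.max 1 (omega_bar * e * (1 + e * phi_bar * rho * psi_bar))
  + e * omega_bar * (phi_bar * rho * psi_bar * e + 1).

End Problem.

(* Main.v *)
(** For prescribed values [lam r] at the nodes [t r] and prescribed moments
    [mom j = \int_0^T psi_j x], the equation is an ordinary linear system on each
    subinterval, solved by variation of constants.  Computing the moments of that
    solution gives a linear system for [mom] with matrix [I - G]; eliminating
    [mom], the continuity of [x] at the interior nodes and the multipoint
    condition become the linear system with matrix [Qstar] for [lam].  Hence
    [lam], then [mom], then [x] are determined by the data, and conversely the
    solution of the two systems yields a solution of the problem.  The estimate
    applies Gronwall's inequality on each subinterval and the operator norms of
    the two inverse matrices; uniqueness is the estimate for zero data. *)

Require Import Defs.
From HB Require Import structures.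
From mathcomp Require Import all_boot all_order all_algebra.
From mathcomp Require Import all_classical all_reals all_analysis.
From mathcomp Require Import ring.

Set Implicit Arguments.
Unset Strict Implicit.
Unset Printing Implicit Defensive.

Import Order.TTheory GRing.Theory Num.Theory.
Import numFieldNormedType.Exports.

Local Open Scope classical_set_scope.
Local Open Scope ring_scope.

(** On each piece the solution is split as x = lambda_r + u_r with u_r vanishing at the left node.
    This puts A lambda_r into the forcing, which is why propagations of A occur in V and D. The
    system with matrix I - G then has the moments of the u_r as unknown, and the moments of the step
    function lambda are added back afterwards. The value x(T) is not among the unknowns: it is
    expressed through the last piece, hence the products of B_m with D in the first row of Q. The
    fundamental matrices are never estimated. Every propagated term is read as the solution of a
    linear problem with zero initial value, so that Gronwall bounds it by the data alone. In the
    final constant, e^(alpha omega) - 1 comes from the forcing A lambda_r, rho from solving for the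
    moments, 1 + |B_m| from the multipoint row of the right-hand side, and the 1 inside the maximum
    from d in that row. *)

Section MatrixFunctions.
Variable R : realType.

(** * Entrywise continuity and differentiability of matrix functions *)

Lemma cvg_mxP (S : topologicalType) (F : set_system S) (FF : Filter F)
    (p q : nat) (M : S -> 'M[R]_(p, q)) (N : 'M[R]_(p, q)) :
  M x @[x --> F] --> N <-> forall i j, M x i j @[x --> F] --> N i j.
Proof.
split=> [MN i j|MN].
  have ce : {for N, continuous (fun L : 'M[R]_(p, q) => L i j)}.
    exact: coord_continuous.
  exact: (@continuous_cvg _ _ _ F FF _ _ _ ce MN).
apply/cvgrPdist_le => /= e e0; near=> x.
rewrite /Num.Def.normr/= mx_normrE (bigmax_le _ (ltW e0))//= => i _.
rewrite !mxE/=; move: i; near: x; apply: filter_forall => /= i.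
by move/cvgrPdist_le : (MN i.1 i.2); exact.
Unshelve. all: by end_near. Qed.

Lemma continuous_mxP (S : topologicalType) (p q : nat) (M : S -> 'M[R]_(p, q)) :
  continuous M <-> forall i j, continuous (fun x => M x i j).
Proof.
split=> [cM i j x|cM x]; first by have /cvg_mxP := cM x; exact.
by apply/cvg_mxP => i j; exact: cM.
Qed.

Section Topological.
Variable S : topologicalType.

(** The domain is an arbitrary topological space so that this lemma and its companions also give
    continuity within an interval, by taking a [subspace] for [S]. *)
Lemma continuous_sum (V : normedModType R) (I : Type) (r : seq I) (P : pred I)
    (F : I -> S -> V) :
  (forall i, P i -> continuous (F i)) ->
  continuous (fun x => \sum_(i <- r | P i) F i x).
Proof.
move=> cF x; elim: r => [|i r IH].
  under eq_fun do rewrite big_nil; exact: cvg_cst.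
under eq_fun do rewrite big_cons.
by case: ifP => // Pi; apply: cvgD => //; exact: cF.
Qed.

Lemma continuous_scalar_prod (I : Type) (r : seq I) (P : pred I) (F : I -> S -> R) :
  (forall i, P i -> continuous (F i)) ->
  continuous (fun x => \prod_(i <- r | P i) F i x).
Proof.
move=> cF x; elim: r => [|i r IH].
  under eq_fun do rewrite big_nil; exact: cvg_cst.
under eq_fun do rewrite big_cons.
by case: ifP => // Pi; apply: cvgM => //; exact: cF.
Qed.

Lemma continuous_mulmx (p q r : nat) (F : S -> 'M[R]_(p, q)) (G : S -> 'M[R]_(q, r)) :
  continuous F -> continuous G -> continuous (fun x => F x *m G x).
Proof.
move=> /continuous_mxP cF /continuous_mxP cG; apply/continuous_mxP => i j.
under eq_fun do rewrite mxE.
by apply: (@continuous_sum R^o) => l _ x; apply: cvgM; [exact: cF|exact: cG].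
Qed.

Lemma continuous_mulmxr (p q r : nat) (F : S -> 'M[R]_(p, q)) (C : 'M[R]_(q, r)) :
  continuous F -> continuous (fun x => F x *m C).
Proof. by move=> cF; apply: (continuous_mulmx cF) => x; exact: cvg_cst. Qed.

Lemma continuous_det (p : nat) (F : S -> 'M[R]_p) :
  continuous F -> continuous (fun x => \det (F x)).
Proof.
move=> /continuous_mxP cF; apply: (@continuous_sum R^o) => s _ x.
apply: cvgM; first exact: cvg_cst.
by apply: continuous_scalar_prod => i _; exact: cF.
Qed.

Lemma continuous_adjugate (p : nat) (F : S -> 'M[R]_p) :
  continuous F -> continuous (fun x => \adj (F x)).
Proof.
move=> /continuous_mxP cF; apply/continuous_mxP => i j.
under eq_fun do rewrite mxE.
move=> x; apply: cvgM; first exact: cvg_cst.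
apply: continuous_det; apply/continuous_mxP => a b.
under eq_fun do rewrite !mxE.
exact: cF.
Qed.

End Topological.

(** Cramer's rule: determinant and adjugate are polynomial in the entries. The quotient formula
    agrees with [invmx] only at invertible values, so the two functions are compared within [K]
    only. *)
Lemma within_continuous_invmx (K : set R) (p : nat) (F : R -> 'M[R]_p) :
  {within K, continuous F} -> (forall s, K s -> F s \in unitmx) ->
  {within K, continuous (fun s => invmx (F s))}.
Proof.
move=> cF uF.
pose G : subspace K -> 'M[R]_p := fun s => (\det (F s))^-1 *: \adj (F s).
apply: (@subspace_eq_continuous _ _ _ G).
  by move=> s /set_mem Ks; rewrite /from_subspace /G/= /invmx uF.
apply/subspace_continuousP => s Ks; apply: cvgZ.
  apply: cvgV; first by have := uF _ Ks; rewrite unitmxE unitfE.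
  by move/subspace_continuousP : (continuous_det cF); exact.
by move/subspace_continuousP : (continuous_adjugate cF); exact.
Qed.

Lemma is_derive_mxP (p q : nat) (F : R -> 'M[R]_(p, q)) (s : R) (D : 'M[R]_(p, q)) :
  is_derive s 1 F D <->
  forall i j, is_derive s 1 (fun x => F x i j) (D i j).
Proof.
split=> [[dF <-] i j|dF].
  move: (dF) => /derivable_mxP dF'.
  by split=> //; rewrite derive_mx// mxE.
have dF' : derivable F s 1 by apply/derivable_mxP => i j; case: (dF i j).
split=> //; rewrite derive_mx//; apply/matrixP => i j; rewrite mxE.
exact: derive_val.
Qed.

Lemma is_derive_mulmx (p q r : nat) (F : R -> 'M[R]_(p, q)) (G : R -> 'M[R]_(q, r))
    (s : R) (D : 'M[R]_(p, q)) (E : 'M[R]_(q, r)) :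
  is_derive s 1 F D -> is_derive s 1 G E ->
  is_derive s 1 (fun x => F x *m G x) (D *m G s + F s *m E).
Proof.
move=> /is_derive_mxP dF /is_derive_mxP dG; apply/is_derive_mxP => i j.
rewrite !mxE -big_split/=.
rewrite (_ : (fun x => _) = \sum_(l < q) (fun x => F x i l * G x l j)); last first.
  by apply/funext => x; rewrite mxE fct_sumE.
apply: is_derive_sum => l.
have dM := is_deriveM (dF i l) (dG l j).
apply: (is_derive_eq dM).
by rewrite /GRing.scale/= addrC mulrC [X in _ + X]mulrC; ring.
Qed.

End MatrixFunctions.

(** * Integrals of matrix functions, and the operator norm *)

Section MatrixIntegral.
Variable R : realType.
Notation mu := (@lebesgue_measure R).

Lemma mx_normP (p q : nat) (M : 'M[R]_(p, q)) (c : R) :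
  0 <= c -> `|M| <= c <-> forall i j, `|M i j| <= c.
Proof.
move=> c0; rewrite {1}/Num.Def.normr/= mx_normrE; split=> [Mc i j|Mc].
  by apply: le_trans Mc; exact: (le_bigmax _ (fun ij => `|M ij.1 ij.2|) (i, j)).
by apply: bigmax_le => // -[i j] _; exact: Mc.
Qed.

Lemma mx_entry_le_norm (p q : nat) (M : 'M[R]_(p, q)) i j : `|M i j| <= `|M|.
Proof. by have /mx_normP := lexx `|M|; apply. Qed.

Section Scalar.
Variables (a b : R).

Lemma continuous_itv_integrable (f : R -> R) :
  {within `[a, b], continuous f} -> mu.-integrable `[a, b] (EFin \o f).
Proof.
by move=> cf; apply: continuous_compact_integrable => //; exact: segment_compact.
Qed.

Lemma le_continuous_Rintegral (f g : R -> R) :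
  {within `[a, b], continuous f} -> {within `[a, b], continuous g} ->
  (forall s, s \in `[a, b] -> f s <= g s) ->
  \int[mu]_(s in `[a, b]) f s <= \int[mu]_(s in `[a, b]) g s.
Proof.
move=> cf cg fg; apply: le_Rintegral => //; exact: continuous_itv_integrable.
Qed.

Lemma Rintegral_itv_cat (c : R) (f : R -> R) :
  {within `[a, b], continuous f} -> a <= c -> c <= b ->
  \int[mu]_(s in `[a, b]) f s =
  \int[mu]_(s in `[a, c]) f s + \int[mu]_(s in `[c, b]) f s.
Proof.
move=> cf ac cb; have If := continuous_itv_integrable cf.
(* The difference of the integrals from [a] is an integral over the half-open interval starting at
   [c]; dropping the point [c] does not change the value. *)
rewrite -(@Rintegral_itv_obnd_cbnd _ c); last first.
  apply: integrableS If => //; apply: subset_itvr; by rewrite bnd_simp.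
by rewrite -(@Rintegral_itvB _ _ _ _ c If) ?bnd_simp// addrC subrK.
Qed.

Lemma within_continuous_subitv (V : normedModType R) (c d : R) (F : R -> V) :
  {within `[a, b], continuous F} -> a <= c -> d <= b ->
  {within `[c, d], continuous F}.
Proof.
move=> cF ac db; apply: continuous_subspaceW cF.
by apply: subset_itv; rewrite bnd_simp.
Qed.

Lemma within_continuous_interior (V : normedModType R) (F : R -> V) (s : R) :
  {within `[a, b], continuous F} -> s \in `]a, b[ -> {for s, continuous F}.
Proof.
move=> cF sab.
have : {within `]a, b[, continuous F}.
  by apply: continuous_subspaceW cF; exact: subset_itv_oo_cc.
by rewrite continuous_open_subspace; [apply; exact: mem_set|exact: itv_open].
Qed.

Lemma eq_within_continuous (V : normedModType R) (F G : R -> V) :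
  (forall s, s \in `[a, b] -> F s = G s) ->
  {within `[a, b], continuous F} -> {within `[a, b], continuous G}.
Proof.
move=> FG; apply: subspace_eq_continuous => s /set_mem.
by rewrite /from_subspace /=; exact: FG.
Qed.

Lemma Rintegral_FTC2 (f F : R -> R) : a <= b ->
  {within `[a, b], continuous f} -> {within `[a, b], continuous F} ->
  (forall s, s \in `]a, b[ -> is_derive s 1 F (f s)) ->
  \int[mu]_(s in `[a, b]) f s = F b - F a.
Proof.
rewrite le_eqVlt => /predU1P[<- _ _ _|ab cf cF dF].
  by rewrite set_itv1 Rintegral_set1 subrr.
rewrite /Rintegral (@continuous_FTC2 _ f F)//.
- move/(continuous_within_itvP _ ab) : cF => [cF Fa Fb]; split=> // s sab.
  by have [] := dF _ sab.
- by move=> s sab; rewrite derive1E; have [] := dF _ sab.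
Qed.

(** The supremum of an unbounded set is a default value; this bound is what lets [alpha] and [norm1]
    dominate the quantities they are taken over. *)
Lemma within_continuous_has_ubound (f : R -> R) :
  {within `[a, b], continuous f} -> has_ubound [set f s | s in `[a, b]].
Proof.
move=> cf.
have [M [_ HM]] : bounded_set [set f s | s in `[a, b]].
  by apply: compact_bounded; apply: continuous_compact => //; exact: segment_compact.
exists (M + 1) => _ [s sab <-].
have M1 : M < M + 1 by rewrite ltrDl.
exact: le_trans (ler_norm _) (HM _ M1 (f s) (ex_intro2 _ _ s sab erefl)).
Qed.

Lemma Rintegral_itv_cst (c : R) : a <= b ->
  \int[mu]_(s in `[a, b]) c = c * (b - a).
Proof.
move=> ab; rewrite Rintegral_cst//.
rewrite [X in fine X](lebesgue_measure_itv `[a, b])/= lte_fin.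
by case: ltP => // ba; rewrite (_ : b = a) ?subrr//; apply/eqP; rewrite eq_le ba.
Qed.

Lemma is_derive_Rintegral (f : R -> R) (s : R) :
  {within `[a, b], continuous f} -> s \in `]a, b[ ->
  is_derive s 1 (fun x => \int[mu]_(y in `[a, x]) f y) (f s).
Proof.
move=> cf sab; have := sab; rewrite in_itv/= => /andP[as_ sb].
have [|dF F's] :=
  @continuous_FTC1_closed _ f a s b sb (continuous_itv_integrable cf) as_.
  exact: within_continuous_interior cf sab.
split; [exact: dF|by rewrite -derive1E].
Qed.

End Scalar.

Section Matrix.
Variables (a b : R).

Lemma eq_mxint (p q : nat) (F G : R -> 'M[R]_(p, q)) :
  (forall s, s \in `[a, b] -> F s = G s) -> mxint a b F = mxint a b G.
Proof.
move=> FG; apply/matrixP => i j; rewrite !mxE; apply: eq_Rintegral => s /set_mem.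
by move=> /FG ->.
Qed.

Lemma mxintD (p q : nat) (F G : R -> 'M[R]_(p, q)) :
  {within `[a, b], continuous F} -> {within `[a, b], continuous G} ->
  mxint a b (fun s => F s + G s) = mxint a b F + mxint a b G.
Proof.
move=> /continuous_mxP cF /continuous_mxP cG; apply/matrixP => i j; rewrite !mxE.
under eq_Rintegral do rewrite mxE.
by rewrite RintegralD//; apply: continuous_itv_integrable; [exact: cF|exact: cG].
Qed.

Lemma mxint0 (p q : nat) : mxint a b (fun=> 0 : 'M[R]_(p, q)) = 0.
Proof.
apply/matrixP => i j; rewrite !mxE.
by rewrite Rintegral_cst// mul0r.
Qed.

Lemma mxint_sum (I : Type) (r : seq I) (P : pred I) (p q : nat)
    (F : I -> R -> 'M[R]_(p, q)) :
  (forall i, P i -> {within `[a, b], continuous (F i)}) ->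
  mxint a b (fun s => \sum_(i <- r | P i) F i s)
  = \sum_(i <- r | P i) mxint a b (F i).
Proof.
move=> cF; elim: r => [|i r IH].
  by rewrite big_nil; under eq_fun do rewrite big_nil; exact: mxint0.
rewrite big_cons; under eq_fun do rewrite big_cons.
case: ifP => Pi; last exact: IH.
rewrite mxintD ?IH//; first exact: cF.
exact: (continuous_sum (S := subspace `[a, b])).
Qed.

Lemma mxint_mulmxl (p q r : nat) (C : 'M[R]_(p, q)) (F : R -> 'M[R]_(q, r)) :
  {within `[a, b], continuous F} ->
  mxint a b (fun s => C *m F s) = C *m mxint a b F.
Proof.
move=> /continuous_mxP cF; apply/matrixP => i j; rewrite !mxE.
have cI l : mu.-integrable `[a, b] (EFin \o (fun s => F s l j)).
  by apply: continuous_itv_integrable; exact: cF.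
(* The scalar sum is viewed as a sum of 1 x 1 matrices, so that [mxint_sum] exchanges it with the
   integral. *)
transitivity (mxint a b (fun s => \sum_l (C i l * F s l j)%:M : 'M[R]_1) 0 0).
  rewrite mxE; apply: eq_Rintegral => s _; rewrite mxE summxE.
  by apply: eq_bigr => l _; rewrite mxE eqxx.
rewrite mxint_sum; last first.
  move=> l _; apply/continuous_mxP => u v.
  rewrite (ord1 u) (ord1 v).
  rewrite (_ : (fun s => _) = (fun s => C i l * F s l j)); last first.
    by apply/funext => s; rewrite mxE eqxx mulr1n.
  by move=> s; apply: cvgM; [exact: cvg_cst|exact: cF].
rewrite summxE; apply: eq_bigr => l _; rewrite !mxE -RintegralZl//.
by apply: eq_Rintegral => s _; rewrite mxE eqxx.
Qed.

Lemma trmx_mxint (p q : nat) (F : R -> 'M[R]_(p, q)) :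
  (mxint a b F)^T = mxint a b (fun s => (F s)^T).
Proof.
by apply/matrixP => i j; rewrite !mxE; apply: eq_Rintegral => s _; rewrite mxE.
Qed.

Lemma mxint_mulmxr (p q r : nat) (C : 'M[R]_(q, r)) (F : R -> 'M[R]_(p, q)) :
  {within `[a, b], continuous F} ->
  mxint a b (fun s => F s *m C) = mxint a b F *m C.
Proof.
move=> /continuous_mxP cF; apply: trmx_inj; rewrite trmx_mul !trmx_mxint.
rewrite -mxint_mulmxl; last first.
  apply/continuous_mxP => i j.
  rewrite (_ : (fun s => _) = (fun s => F s j i)); first exact: cF.
  by apply/funext => s; rewrite mxE.
by apply: eq_mxint => s _; rewrite trmx_mul.
Qed.

Lemma mxintN (p q : nat) (F : R -> 'M[R]_(p, q)) :
  {within `[a, b], continuous F} ->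
  mxint a b (fun s => - F s) = - mxint a b F.
Proof.
move=> cF; rewrite -[in RHS](mul1mx (mxint a b F)) -mulNmx -mxint_mulmxl//.
by apply: eq_mxint => s _; rewrite mulNmx mul1mx.
Qed.

Lemma mxint_cat (p q : nat) (c : R) (F : R -> 'M[R]_(p, q)) :
  {within `[a, b], continuous F} -> a <= c -> c <= b ->
  mxint a b F = mxint a c F + mxint c b F.
Proof.
move=> /continuous_mxP cF ac cb; apply/matrixP => i j; rewrite !mxE.
by apply: Rintegral_itv_cat => //; exact: cF.
Qed.

Lemma mxint_point (p q : nat) (F : R -> 'M[R]_(p, q)) : mxint a a F = 0.
Proof. by apply/matrixP => i j; rewrite !mxE set_itv1 Rintegral_set1. Qed.

Lemma continuous_mxint (p q : nat) (F : R -> 'M[R]_(p, q)) : a <= b ->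
  {within `[a, b], continuous F} ->
  {within `[a, b], continuous (fun s => mxint a s F)}.
Proof.
move=> ab /continuous_mxP cF; apply/continuous_mxP => i j.
rewrite (_ : (fun s => _) =
    (fun s => \int[mu]_(y in `[a, s]) F y i j)); last first.
  by apply/funext => s; rewrite mxE.
apply: parameterized_integral_continuous => //.
by apply: continuous_itv_integrable; exact: cF.
Qed.

Lemma is_derive_mxint (p q : nat) (F : R -> 'M[R]_(p, q)) (s : R) :
  {within `[a, b], continuous F} -> s \in `]a, b[ ->
  is_derive s 1 (fun x => mxint a x F) (F s).
Proof.
move=> /continuous_mxP cF sab; apply/is_derive_mxP => i j.
rewrite (_ : (fun s => _) =
    (fun s => \int[mu]_(y in `[a, s]) F y i j)); last first.
  by apply/funext => x; rewrite mxE.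
by apply: is_derive_Rintegral sab; exact: cF.
Qed.

Lemma mxint_FTC2 (p q : nat) (F U : R -> 'M[R]_(p, q)) : a <= b ->
  {within `[a, b], continuous F} -> {within `[a, b], continuous U} ->
  (forall s, s \in `]a, b[ -> is_derive s 1 U (F s)) ->
  mxint a b F = U b - U a.
Proof.
move=> ab /continuous_mxP cF /continuous_mxP cU dU; apply/matrixP => i j.
rewrite !mxE.
apply: (@Rintegral_FTC2 a b (fun s => F s i j) (fun s => U s i j)) => //.
- exact: cF.
- exact: cU.
- by move=> s /dU /is_derive_mxP.
Qed.

(** The norm is the largest absolute entry, so the scalar inequality applied to each entry suffices
    and no factor depending on the size appears. *)
Lemma norm_mxint_le (p q : nat) (F : R -> 'M[R]_(p, q)) (g : R -> R) :
  {within `[a, b], continuous F} -> {within `[a, b], continuous g} ->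
  (forall s, s \in `[a, b] -> `|F s| <= g s) ->
  `|mxint a b F| <= \int[mu]_(s in `[a, b]) g s.
Proof.
move=> /continuous_mxP cF cg Fg; apply/mx_normP.
  by apply: Rintegral_ge0 => s sab; apply: le_trans (Fg s sab).
move=> i j; rewrite mxE; apply: le_trans (le_normr_Rintegral _ _) _ => //.
  by apply: continuous_itv_integrable; exact: cF.
apply: le_continuous_Rintegral => // [|s sab].
  by move=> s; apply: cvg_norm; exact: cF.
by apply: le_trans (Fg s sab); exact: mx_entry_le_norm.
Qed.

End Matrix.

Section OperatorNorm.
Variables p q : nat.
Implicit Type M : 'M[R]_(p, q).

(** A crude constant that serves only to make the supremum in [opnorm] finite and [opnorm]
    continuous; the estimates of the theorem rest on [le_opnorm]. *)
Lemma norm_mulmx_le M (x : 'cV[R]_q) : `|M *m x| <= q%:R * `|M| * `|x|.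
Proof.
apply/mx_normP => [|i j]; first by rewrite !mulr_ge0.
rewrite mxE; apply: le_trans (ler_norm_sum _ _ _) _.
apply: (@le_trans _ _ (\sum_(l < q) `|M| * `|x|)).
  by apply: ler_sum => l _; rewrite normrM ler_pM// mx_entry_le_norm.
by rewrite sumr_const card_ord -[leLHS]mulr_natl mulrA.
Qed.

Lemma opnorm_has_sup M :
  has_sup [set `|M *m x| | x in [set x : 'cV[R]_q | `|x| <= 1]].
Proof.
split; first by exists 0; exists 0; rewrite /= ?mulmx0 normr0.
exists (q%:R * `|M|) => _ [x /= x1 <-]; apply: le_trans (norm_mulmx_le _ _) _.
by rewrite ler_piMr// mulr_ge0.
Qed.

Lemma opnorm_ge0 M : 0 <= opnorm M.
Proof.
apply: (ub_le_sup (opnorm_has_sup M).2).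
by exists 0; rewrite /= ?mulmx0 normr0.
Qed.

Lemma opnorm_le M (c : R) :
  (forall x : 'cV[R]_q, `|x| <= 1 -> `|M *m x| <= c) -> opnorm M <= c.
Proof.
move=> Mc; apply: ge_sup; first exact: (opnorm_has_sup M).1.
by move=> _ [x x1 <-]; exact: Mc.
Qed.

Lemma le_opnorm M (x : 'cV[R]_q) : `|M *m x| <= opnorm M * `|x|.
Proof.
have [->|x0] := eqVneq x 0; first by rewrite mulmx0 !normr0 mulr0.
have nx : 0 < `|x| by rewrite normr_gt0.
rewrite -ler_pdivrMr// mulrC -[`|x|^-1]gtr0_norm ?invr_gt0// -normrZ scalemxAr.
apply: (ub_le_sup (opnorm_has_sup M).2).
exists (`|x|^-1 *: x) => //=.
by rewrite normrZ gtr0_norm ?invr_gt0// mulVf// gt_eqF.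
Qed.

Lemma opnorm_lipschitz M N : opnorm M <= opnorm N + q%:R * `|M - N|.
Proof.
apply: opnorm_le => x x1; rewrite -(subrK N M) mulmxDl.
rewrite addrC addrK; apply: le_trans (ler_normD _ _) _; apply: lerD.
  by apply: le_trans (le_opnorm _ _) _; rewrite ler_piMr// opnorm_ge0.
by apply: le_trans (norm_mulmx_le _ _) _; rewrite ler_piMr// mulr_ge0.
Qed.

Lemma continuous_opnorm (S : topologicalType) (F : S -> 'M[R]_(p, q)) :
  continuous F -> continuous (fun x => opnorm (F x)).
Proof.
move=> cF x; apply/cvgrPdist_le => /= e e0.
(* The Lipschitz constant is [q]; dividing by [q.+1] also covers [q = 0]. *)
have d0 : 0 < e / q.+1%:R by rewrite divr_gt0.
have /cvgrPdist_le/(_ _ d0) := cF x; apply: filterS => y /= xy.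
have H : q%:R * `|F x - F y| <= e.
  apply: le_trans (ler_wpM2l _ xy) _ => //.
  by rewrite mulrCA ler_piMr ?(ltW e0)// ler_pdivrMr// mul1r ler_nat.
rewrite ler_distl; apply/andP; split.
  rewrite lerBlDr; apply: le_trans (opnorm_lipschitz _ (F x)) _.
  by rewrite lerD2l distrC.
by apply: le_trans (opnorm_lipschitz _ (F y)) _; rewrite lerD2l.
Qed.

End OperatorNorm.

End MatrixIntegral.

(** * Linear differential equations: Gronwall, variation of constants, gluing *)

Section LinearODE.
Variable R : realType.
Notation mu := (@lebesgue_measure R).

Lemma gronwall (al c a b : R) (v g : R -> R) :
  0 <= al -> {within `[a, b], continuous v} -> {within `[a, b], continuous g} ->
  (forall s, s \in `[a, b] -> 0 <= g s) ->
  (forall s, s \in `[a, b] ->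
     v s <= c + \int[mu]_(y in `[a, s]) (al * v y + g y)) ->
  forall s, s \in `[a, b] ->
    v s <= expR (al * (s - a)) * (c + \int[mu]_(y in `[a, s]) g y).
Proof.
move=> al0 cv cg g0 vle s sab; have := sab; rewrite in_itv/= => /andP[as_ sb].
have ab := le_trans as_ sb.
pose h y := al * v y + g y.
have ch : {within `[a, b], continuous h}.
  by move=> x; apply: cvgD; [apply: cvgM; [exact: cvg_cst|exact: cv]|exact: cg].
pose w x := c + \int[mu]_(y in `[a, x]) h y.
pose E x := expR (- al * (x - a)).
(* P is nonincreasing because v <= w, and P a = c. *)
pose P x := E x * w x - \int[mu]_(y in `[a, x]) g y.
have dE (x : R) : is_derive x 1 E (- al * E x).
  rewrite (_ : E = expR \o (fun x => - al * (x - a)))//.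
  have dl : is_derive x 1 (fun x => - al * (x - a)) (- al).
    rewrite (_ : (fun x => _) = (- al) *: (id - cst a))//.
    by apply: is_derive_eq; rewrite subr0 /GRing.scale/= mulr1.
  by apply: is_derive_eq; rewrite mulrC.
have dP (x : R) : x \in `]a, b[ ->
    is_derive x 1 P (E x * h x - al * E x * w x - g x).
  move=> xab.
  have dh := is_derive_Rintegral ch xab.
  have dg := is_derive_Rintegral cg xab.
  have dw : is_derive x 1 w (h x).
    rewrite (_ : w = cst c + (fun x => \int[mu]_(y in `[a, x]) h y))//.
    by apply: is_derive_eq; rewrite add0r.
  rewrite (_ : P = E * w - (fun x => \int[mu]_(y in `[a, x]) g y))//.
  apply: is_derive_eq; rewrite /GRing.scale/=; ring.
have cP : {within `[a, b], continuous P}.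
  have cE : {within `[a, b], continuous E}.
    apply: continuous_subspaceT => x.
    by apply: differentiable_continuous; apply/derivable1_diffP; case: (dE x).
  move=> x; apply: cvgB.
    apply: cvgM; first exact: cE.
    apply: cvgD; first exact: cvg_cst.
    by apply: parameterized_integral_continuous => //; exact: continuous_itv_integrable.
  by apply: parameterized_integral_continuous => //; exact: continuous_itv_integrable.
have Pac : P a = c.
  by rewrite /P /w /E subrr mulr0 expR0 mul1r set_itv1 !Rintegral_set1 subr0 addr0.
have Psa : P s <= P a.
  apply: (@ler0_derive1_nincr _ P a b _ _ cP a s (lexx a) as_ sb) => x xab.
    by case: (dP _ xab).
  rewrite derive1E; case: (dP _ xab) => _ ->.
  have xab' : x \in `[a, b] by apply: subset_itv_oo_cc.
  have gx := g0 _ xab'; have := vle _ xab'; rewrite -/(w x) => vw.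
  have E0 : 0 <= E x by exact: expR_ge0.
  have E1 : E x <= 1.
    rewrite -expR0 ler_expR mulNr oppr_le0 mulr_ge0// subr_ge0.
    by move: xab; rewrite in_itv/= => /andP[/ltW].
  (* The first summand is nonpositive because [v <= w], the second because [E x <= 1] and [g >= 0].
     Giving up the weight [E] on [g] is what leaves the plain integral of [g] in the bound. *)
  rewrite (_ : _ - _ = E x * al * (v x - w x) + (E x - 1) * g x); last first.
    by rewrite /h; ring.
  rewrite -[leRHS]addr0 lerD//.
    by rewrite mulr_ge0_le0 ?mulr_ge0// subr_le0.
  by rewrite mulr_le0_ge0// subr_le0.
apply: le_trans (vle _ sab) _; rewrite -/(w s).
have -> : w s = expR (al * (s - a)) * (E s * w s).
  by rewrite mulrA /E -expRD mulNr subrr expR0 mul1r.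
by rewrite ler_wpM2l ?expR_ge0// -lerBlDr -Pac.
Qed.

Variables (n : nat) (A : R -> 'M[R]_n).

Definition linear_ode (a b : R) (q : nat) (F U : R -> 'M[R]_(n, q)) : Prop :=
  {within `[a, b], continuous U} /\
  forall s, s \in `]a, b[ -> is_derive s 1 U (A s *m U s + F s).

Lemma linear_odeB (a b : R) (q : nat) (F G U V : R -> 'M[R]_(n, q)) :
  linear_ode a b F U -> linear_ode a b G V ->
  linear_ode a b (fun s => F s - G s) (fun s => U s - V s).
Proof.
move=> [cU dU] [cV dV]; split=> [|s sab].
  by move=> s; apply: cvgB; [exact: cU|exact: cV].
have := is_deriveB (dU _ sab) (dV _ sab).
by rewrite mulmxBr opprD addrACA.
Qed.

Lemma linear_ode_subitv (a b c d : R) (q : nat) (F U : R -> 'M[R]_(n, q)) :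
  a <= c -> d <= b -> linear_ode a b F U -> linear_ode c d F U.
Proof.
move=> ac db [cU dU]; split; first exact: within_continuous_subitv cU ac db.
move=> s; rewrite in_itv/= => /andP[cs sd]; apply: dU.
by rewrite in_itv/= (le_lt_trans ac)//= (lt_le_trans sd).
Qed.

Lemma linear_ode_integral (a b : R) (q : nat) (F U : R -> 'M[R]_(n, q)) :
  {within `[a, b], continuous A} -> {within `[a, b], continuous F} ->
  linear_ode a b F U ->
  forall s, s \in `[a, b] -> U s = U a + mxint a s (fun y => A y *m U y + F y).
Proof.
move=> cA cF [cU dU] s; rewrite in_itv/= => /andP[as_ sb].
have cH : {within `[a, b], continuous (fun y => A y *m U y + F y)}.
  by move=> y; apply: cvgD; [exact: continuous_mulmx|exact: cF].
suff -> : mxint a s (fun y => A y *m U y + F y) = U s - U a.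
  by rewrite addrC subrK.
apply: (@mxint_FTC2 _ a s n q _ U as_).
- exact: within_continuous_subitv cH _ _.
- exact: within_continuous_subitv cU _ _.
- move=> y; rewrite in_itv/= => /andP[ay ys]; apply: dU.
  by rewrite in_itv/= ay (lt_le_trans ys).
Qed.

Section Bounds.
Variables (a b al : R).
Hypothesis cA : {within `[a, b], continuous A}.
Hypothesis Aal : forall s, s \in `[a, b] -> opnorm (A s) <= al.

Lemma linear_ode_norm_integral (F U : R -> 'cV[R]_n) (g : R -> R) :
  {within `[a, b], continuous F} -> {within `[a, b], continuous g} ->
  (forall s, s \in `[a, b] -> `|F s| <= g s) -> linear_ode a b F U ->
  forall s, s \in `[a, b] ->
    `|U s| <= `|U a| + \int[mu]_(y in `[a, s]) (al * `|U y| + g y).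
Proof.
move=> cF cg Fg oU s sab; rewrite (linear_ode_integral cA cF oU sab).
have := sab; rewrite in_itv/= => /andP[as_ sb]; have [cU _] := oU.
apply: le_trans (ler_normD _ _) _; rewrite lerD2l.
apply: norm_mxint_le.
- have : {within `[a, b], continuous (fun y => A y *m U y + F y)}.
    by move=> y; apply: cvgD; [exact: continuous_mulmx|exact: cF].
  by move/within_continuous_subitv; apply.
- have : {within `[a, b], continuous (fun y => al * `|U y| + g y)}.
    move=> y; apply: cvgD; last exact: cg.
    by apply: cvgM; [exact: cvg_cst|apply: cvg_norm; exact: cU].
  by move/within_continuous_subitv; apply.
- move=> y; rewrite in_itv/= => /andP[ay ys].
  have yab : y \in `[a, b] by rewrite in_itv/= ay (le_trans ys).
  apply: le_trans (ler_normD _ _) _; apply: lerD; last exact: Fg.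
  by apply: le_trans (le_opnorm _ _) _; rewrite ler_wpM2r// Aal.
Qed.

Lemma linear_ode_bound (F U : R -> 'cV[R]_n) (g : R -> R) : 0 <= al ->
  {within `[a, b], continuous F} -> {within `[a, b], continuous g} ->
  (forall s, s \in `[a, b] -> `|F s| <= g s) -> linear_ode a b F U ->
  forall s, s \in `[a, b] ->
    `|U s| <= expR (al * (s - a)) * (`|U a| + \int[mu]_(y in `[a, s]) g y).
Proof.
move=> al0 cF cg Fg oU s sab; have [cU _] := oU.
apply: (@gronwall al `|U a| a b (fun s => `|U s|) g) sab => //.
- by move=> x; apply: cvg_norm; exact: cU.
- by move=> x xab; apply: le_trans (Fg _ xab).
- exact: linear_ode_norm_integral Fg oU.
Qed.

(* Gronwall applied to |U| + |x| gives the factor e^(al (s - a)) - 1. *)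
Lemma linear_ode_bound_const (U : R -> 'cV[R]_n) (x : 'cV[R]_n) : 0 <= al ->
  linear_ode a b (fun s => A s *m x) U -> U a = 0 ->
  forall s, s \in `[a, b] -> `|U s| <= (expR (al * (s - a)) - 1) * `|x|.
Proof.
move=> al0 oU Ua s sab; have [cU _] := oU.
have cF : {within `[a, b], continuous (fun s => A s *m x)}.
  by apply: continuous_mulmx => // ?; exact: cvg_cst.
have := @gronwall al `|x| a b (fun s => `|U s| + `|x|) (fun=> 0) al0.
rewrite mulrBl mul1r lerBrDr => /(_ _ _ _ _ s sab).
rewrite Rintegral_cst// mul0r addr0; apply.
- move=> y; apply: cvgD; last exact: cvg_cst.
  by apply: cvg_norm; exact: cU.
- by move=> y; exact: cvg_cst.
- by [].
- move=> y yab; rewrite addrC lerD2l.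
  apply: le_trans.
    apply: (linear_ode_norm_integral (g := fun=> al * `|x|)) oU _ yab => //.
      by move=> z; exact: cvg_cst.
    move=> z zab; apply: le_trans (le_opnorm _ _) _.
    by rewrite ler_wpM2r// Aal.
  rewrite Ua normr0 add0r le_eqVlt; apply/orP; left; apply/eqP.
  by apply: eq_Rintegral => z _; rewrite mulrDr addr0.
Qed.

End Bounds.

Lemma linear_ode_unique (a b : R) (F U V : R -> 'cV[R]_n) :
  {within `[a, b], continuous A} ->
  linear_ode a b F U -> linear_ode a b F V -> U a = V a ->
  forall s, s \in `[a, b] -> U s = V s.
Proof.
move=> cA oU oV UV s sab.
have ub := within_continuous_has_ubound (continuous_opnorm cA).
pose al := sup [set opnorm (A s) | s in `[a, b]].
have Aal x : x \in `[a, b] -> opnorm (A x) <= al.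
  by move=> xab; apply: (ub_le_sup ub); exists x.
have al0 : 0 <= al by apply: le_trans (Aal _ sab); exact: opnorm_ge0.
have := linear_odeB oU oV; under eq_fun do rewrite subrr; move=> oD.
apply/eqP; rewrite -subr_eq0 -normr_le0.
have B : `|U s - V s| <= expR (al * (s - a)) *
    (`|U a - V a| + \int[mu]_(y in `[a, s]) 0).
  apply: (linear_ode_bound cA Aal (g := fun=> 0) al0 _ _ _ oD sab).
  - by move=> z; exact: cvg_cst.
  - by move=> z; exact: cvg_cst.
  - by move=> z _; rewrite normr0.
apply: le_trans B _.
by rewrite Rintegral_cst// mul0r UV subrr normr0 addr0 mulr0.
Qed.

Section Propagator.
Variables (a b : R) (X : R -> 'M[R]_n).
Hypothesis fundX : fundamental_matrix A a b X.

(** The number of columns is free so that the vector source [f] can be propagated as well as [A] and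
    [phi j]. At [a := t r] and [X := X r] this is convertible to [propagate], on which [GblockE] and
    [VmxE] rely. *)
Definition propagator (q : nat) (F : R -> 'M[R]_(n, q)) (s : R) : 'M[R]_(n, q) :=
  X s *m mxint a s (fun y => invmx (X y) *m F y).

Lemma propagator_integrand_continuous (q : nat) (F : R -> 'M[R]_(n, q)) :
  {within `[a, b], continuous F} ->
  {within `[a, b], continuous (fun y => invmx (X y) *m F y)}.
Proof.
move=> cF; apply: continuous_mulmx cF; have [cX _ uX] := fundX.
exact: within_continuous_invmx.
Qed.

Lemma propagator_init (q : nat) (F : R -> 'M[R]_(n, q)) : propagator F a = 0.
Proof. by rewrite /propagator mxint_point mulmx0. Qed.

Lemma fundamental_linear_ode (q : nat) (F : R -> 'M[R]_(n, q))
    (c : 'M[R]_(n, q)) : a <= b -> {within `[a, b], continuous F} ->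
  linear_ode a b F (fun s => X s *m (c + mxint a s (fun y => invmx (X y) *m F y))).
Proof.
move=> ab cF; have [cX dX uX] := fundX.
have cI := propagator_integrand_continuous cF.
split.
  apply: (continuous_mulmx cX) => s; apply: cvgD; first exact: cvg_cst.
  exact: (continuous_mxint ab cI).
move=> s sab.
have sab' : s \in `[a, b] by apply: subset_itv_oo_cc.
have dc : is_derive s 1 (cst c : R -> 'M[R]_(n, q)) 0 by exact: is_derive_cst.
have := is_deriveD dc (is_derive_mxint cI sab); rewrite add0r => dI.
have := is_derive_mulmx (dX _ sab) dI.
by rewrite (mulmxA (X s) (invmx _)) mulmxV ?uX// mul1mx mulmxA.
Qed.

Lemma propagator_linear_ode (q : nat) (F : R -> 'M[R]_(n, q)) :
  a <= b -> {within `[a, b], continuous F} -> linear_ode a b F (propagator F).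
Proof.
move=> ab cF; have := fundamental_linear_ode 0 ab cF.
by under eq_fun do rewrite add0r.
Qed.

Lemma propagator_continuous (q : nat) (F : R -> 'M[R]_(n, q)) :
  a <= b -> {within `[a, b], continuous F} ->
  {within `[a, b], continuous (propagator F)}.
Proof. by move=> ab cF; case: (propagator_linear_ode ab cF). Qed.

(** By uniqueness, any solution with zero initial value is given by this closed formula; in
    particular the formula does not depend on the choice of the fundamental matrix. *)
Lemma propagatorE (F U : R -> 'cV[R]_n) : {within `[a, b], continuous A} ->
  {within `[a, b], continuous F} -> linear_ode a b F U -> U a = 0 ->
  forall s, s \in `[a, b] -> U s = propagator F s.
Proof.
move=> cA cF oU Ua s sab.
have ab : a <= b by move: sab; rewrite in_itv/= => /andP[/le_trans]; apply.
apply: (linear_ode_unique cA oU (propagator_linear_ode ab cF) _ sab).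
by rewrite propagator_init.
Qed.

Lemma propagatorD (q : nat) (F G : R -> 'M[R]_(n, q)) (s : R) :
  {within `[a, b], continuous F} -> {within `[a, b], continuous G} ->
  s \in `[a, b] ->
  propagator (fun y => F y + G y) s = propagator F s + propagator G s.
Proof.
move=> cF cG; rewrite in_itv/= => /andP[as_ sb].
rewrite /propagator -mulmxDr -mxintD.
- by under [in LHS]eq_mxint do rewrite mulmxDr.
- exact: within_continuous_subitv (propagator_integrand_continuous cF) _ _.
- exact: within_continuous_subitv (propagator_integrand_continuous cG) _ _.
Qed.

Lemma propagator_sum (I : Type) (r : seq I) (q : nat)
    (F : I -> R -> 'M[R]_(n, q)) (s : R) :
  (forall i, {within `[a, b], continuous (F i)}) -> s \in `[a, b] ->
  propagator (fun y => \sum_(i <- r) F i y) s = \sum_(i <- r) propagator (F i) s.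
Proof.
move=> cF; rewrite in_itv/= => /andP[as_ sb].
rewrite /propagator -mulmx_sumr -mxint_sum.
  by under [in LHS]eq_mxint do rewrite mulmx_sumr.
move=> i _.
exact: within_continuous_subitv (propagator_integrand_continuous (cF i)) _ _.
Qed.

Lemma propagator_mulmxr (q r : nat) (F : R -> 'M[R]_(n, q)) (C : 'M[R]_(q, r))
    (s : R) : {within `[a, b], continuous F} -> s \in `[a, b] ->
  propagator (fun y => F y *m C) s = propagator F s *m C.
Proof.
move=> cF; rewrite in_itv/= => /andP[as_ sb].
rewrite /propagator -mulmxA -mxint_mulmxr.
  by under [in LHS]eq_mxint do rewrite mulmxA.
exact: within_continuous_subitv (propagator_integrand_continuous cF) _ _.
Qed.

Lemma fundamental_ivp (F : R -> 'cV[R]_n) (x0 : 'cV[R]_n) :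
  a <= b -> {within `[a, b], continuous F} ->
  exists U, linear_ode a b F U /\ U a = x0.
Proof.
move=> ab cF; have [_ _ uX] := fundX.
exists (fun s => X s *m (invmx (X a) *m x0 + mxint a s (fun y => invmx (X y) *m F y))).
split; first exact: fundamental_linear_ode.
rewrite mxint_point addr0 mulmxA mulmxV ?mul1mx// uX//.
by rewrite in_itv/= lexx.
Qed.

End Propagator.

(* The glued function satisfies the integral equation on all of [a, c], so the
   fundamental theorem of calculus gives its derivative at the junction b. *)
Lemma linear_ode_glue (a b c : R) (F U V : R -> 'cV[R]_n) :
  a <= b -> b <= c ->
  {within `[a, c], continuous A} -> {within `[a, c], continuous F} ->
  linear_ode a b F U -> linear_ode b c F V -> U b = V b ->
  exists W, linear_ode a c F W /\ W a = U a.
Proof.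
move=> ab bc cA cF oU oV UV; have [cU _] := oU; have [cV _] := oV.
pose W s := if s <= b then U s else V s.
have WU s : s \in `[a, b] -> W s = U s.
  by rewrite /W in_itv/= => /andP[_ ->].
have WV s : s \in `[b, c] -> W s = V s.
  rewrite /W in_itv/= => /andP[bs _]; case: ifPn => // sb.
  by have -> : s = b by apply/eqP; rewrite eq_le sb.
have cW : {within `[a, c], continuous W}.
  have : {within `[a, b] `|` `[b, c], continuous W}.
    apply: withinU_continuous.
    - exact: interval_closed.
    - exact: interval_closed.
    - by apply: eq_within_continuous cU => s sab; rewrite WU.
    - by apply: eq_within_continuous cV => s sab; rewrite WV.
  apply: continuous_subspaceW => s /=; rewrite !in_itv/= => /andP[as_ sc].
  by have [sb|/ltW bs] := leP s b; [left|right]; rewrite ?as_ ?sb ?bs.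
pose H y := A y *m W y + F y.
have cH : {within `[a, c], continuous H}.
  by move=> y; apply: cvgD; [exact: continuous_mulmx|exact: cF].
have sub (u v : R) : a <= u -> v <= c ->
    {within `[u, v], continuous A} /\ {within `[u, v], continuous F}.
  by move=> au vc; split; [exact: within_continuous_subitv cA _ _|
                           exact: within_continuous_subitv cF _ _].
have [cA1 cF1] := sub a b (lexx _) bc; have [cA2 cF2] := sub b c ab (lexx _).
have E1 s : s \in `[a, b] -> W s = U a + mxint a s H.
  move=> sab; rewrite WU// (linear_ode_integral cA1 cF1 oU sab); congr (_ + _).
  apply: eq_mxint => y; rewrite in_itv/= => /andP[ay ys]; rewrite /H WU//.
  by move: sab; rewrite !in_itv/= ay => /andP[_ /(le_trans ys)].
have E2 s : s \in `[b, c] -> W s = U a + mxint a s H.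
  move=> sbc; have := sbc; rewrite in_itv/= => /andP[bs sc].
  have bab : b \in `[a, b] by rewrite in_itv/= ab lexx.
  rewrite WV// (linear_ode_integral cA2 cF2 oV sbc) -UV -(WU b bab) (E1 b bab).
  rewrite -addrA; congr (_ + _).
  rewrite [in RHS](mxint_cat (c := b))//; last first.
    exact: within_continuous_subitv cH _ _.
  congr (_ + _); apply: eq_mxint => y; rewrite in_itv/= => /andP[by_ ys].
  by rewrite /H WV// in_itv/= by_ (le_trans ys sc).
have EW s : s \in `[a, c] -> W s = U a + mxint a s H.
  rewrite in_itv/= => /andP[as_ sc].
  by have [sb|/ltW bs] := leP s b; [apply: E1|apply: E2]; rewrite in_itv/= ?as_ ?sb ?bs.
(* [W] is known to equal this integral only on [[a, c]], so the integral itself is the witness; its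
   derivative [H s] involves [W s], which is rewritten back by [EW]. *)
pose W' s := U a + mxint a s H.
exists W'; split; last by rewrite /W' mxint_point addr0.
have ac := le_trans ab bc.
split.
  move=> s; apply: cvgD; first exact: cvg_cst.
  exact: continuous_mxint.
move=> s sac.
have dc : is_derive s 1 (cst (U a) : R -> 'cV[R]_n) 0 by exact: is_derive_cst.
have := is_deriveD dc (is_derive_mxint cH sac); rewrite add0r.
by rewrite /W' -EW//; apply: subset_itv_oo_cc.
Qed.

End LinearODE.

(** * Stacked vectors and their max norm *)

Section BlockColumns.
Variables (R : realType) (p n : nat).

Lemma mul_mxblock_mxcol (B : 'I_p -> 'I_p -> 'M[R]_n) (v : 'I_p -> 'cV[R]_n) :
  (\mxblock_(i, j) B i j) *m (\mxcol_j v j) = \mxcol_i \sum_j B i j *m v j.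
Proof.
rewrite mxblockEv mxcol_mul; apply: eq_mxcol => i.
by rewrite mul_mxrow_mxcol.
Qed.

Lemma norm_mxcol_le (v : 'I_p -> 'cV[R]_n) (c : R) : 0 <= c ->
  (forall i, `|v i| <= c) -> `|\mxcol_i v i| <= c.
Proof.
move=> c0 vc; apply/mx_normP => // i j; rewrite mxE.
exact: le_trans (mx_entry_le_norm _ _ _) (vc _).
Qed.

Lemma le_norm_mxcol (v : 'I_p -> 'cV[R]_n) i : `|v i| <= `|\mxcol_i v i|.
Proof.
apply/mx_normP => // a b; rewrite -[v i](mxcolK v) mxE.
exact: mx_entry_le_norm.
Qed.

End BlockColumns.

(** * Subdivision of the interval and additivity of integrals over it *)

Section Partition.
Variables (R : realType) (t : nat -> R) (m : nat).
Hypothesis t_incr : forall r : nat, (r < m)%N -> t r < t r.+1.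
Notation mu := (@lebesgue_measure R).

Lemma partition_le i j : (i <= j)%N -> (j <= m)%N -> t i <= t j.
Proof.
elim: j => [|j IH]; first by rewrite leqn0 => /eqP ->.
rewrite leq_eqVlt => /predU1P[-> //|]; rewrite ltnS => ij jm.
by apply: le_trans (IH ij (ltnW jm)) (ltW (t_incr jm)).
Qed.

Lemma partition_cover j s : (0 < j <= m)%N -> s \in `[t 0%N, t j] ->
  exists2 r, (r < j)%N & s \in `[t r, t r.+1].
Proof.
elim: j => // j IH /= jm; rewrite in_itv/= => /andP[s0 sj].
have [sj'|/ltW js] := leP s (t j); last first.
  by exists j => //; rewrite in_itv/= js.
case: j IH jm sj sj' => [|j] IH jm sj sj'.
  have -> : s = t 0%N by apply/eqP; rewrite eq_le sj' s0.
  by exists 0%N => //; rewrite in_itv/= lexx ltW// t_incr.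
have [||r rj sr] := IH; [exact: ltnW|by rewrite in_itv/= s0|].
by exists r => //; exact: ltnW.
Qed.

Lemma Rintegral_partition (f : R -> R) j : (j <= m)%N ->
  {within `[t 0%N, t m], continuous f} ->
  \int[mu]_(s in `[t 0%N, t j]) f s =
  \sum_(r < j) \int[mu]_(s in `[t r, t r.+1]) f s.
Proof.
move=> + cf; elim: j => [|j IH] jm.
  by rewrite big_ord0 set_itv1 Rintegral_set1.
rewrite big_ord_recr/= -IH ?(ltnW jm)//.
apply: Rintegral_itv_cat.
- exact: within_continuous_subitv cf (lexx _) (partition_le jm (leqnn m)).
- exact: partition_le (leq0n j) (ltnW jm).
- exact: ltW (t_incr jm).
Qed.

Lemma mxint_partition (p q : nat) (F : R -> 'M[R]_(p, q)) :
  {within `[t 0%N, t m], continuous F} ->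
  mxint (t 0%N) (t m) F = \sum_(r < m) mxint (t r) (t r.+1) F.
Proof.
move=> /continuous_mxP cF; apply/matrixP => i j; rewrite mxE summxE.
rewrite Rintegral_partition//; last exact: cF.
by apply: eq_bigr => r _; rewrite mxE.
Qed.

End Partition.

Lemma sum_delta_mulmx (R : realType) (n m : nat) (C : 'M[R]_n) (v : nat -> 'cV[R]_n)
    (j : nat) : (j < m)%N ->
  \sum_(i < m) (if (i : nat) == j then C else 0) *m v i = C *m v j.
Proof.
move=> jm; rewrite (bigD1 (Ordinal jm))//= eqxx big1 ?addr0// => i.
by rewrite -val_eqE/= => /negPf ->; rewrite mul0mx.
Qed.

(** The change of unknown in [momentP]: [a] is the moment of the solution, [b] that of the step
    function, [c] and [e] their images under G, [x] the contribution of [A] and [g] that of the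
    source. *)
Lemma eq_sub_balance (V : zmodType) (a b c e x g : V) :
  a = b + x + c + g <-> a - b - (c - e) = x + e + g.
Proof.
have E : b + x + c + g = x + e + g + (c - e) + b.
  rewrite (addrC c) addrA (addrAC x e g) addrK.
  by rewrite [LHS]addrAC -!addrA addrC !addrA.
split=> [->|H]; first by rewrite E !addrK.
by rewrite E -H !subrK.
Qed.

(** * Reduction to the linear systems for the moments and the node values *)

Section Reduction.
Variables (R : realType) (n k m : nat) (T : R) (t : nat -> R).
Variables (A : R -> 'M[R]_n) (phi psi : 'I_k -> R -> 'M[R]_n).
Variables (B : nat -> 'M[R]_n) (X : nat -> R -> 'M[R]_n).
Hypotheses (m_gt0 : (0 < m)%N) (t0 : t 0%N = 0) (tm : t m = T).
Hypothesis t_incr : forall r : nat, (r < m)%N -> t r < t r.+1.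
Hypothesis cA : {within `[0, T], continuous A}.
Hypothesis cphi : forall j : 'I_k, {within `[0, T], continuous (phi j)}.
Hypothesis cpsi : forall j : 'I_k, {within `[0, T], continuous (psi j)}.
Hypothesis fundX : forall r : nat, (r < m)%N ->
  fundamental_matrix A (t r) (t r.+1) (X r).
Hypothesis regular : IG m t phi psi X \in unitmx.
Hypothesis Qunit : Qstar m t A phi psi B X \in unitmx.

Implicit Types (f : R -> 'cV[R]_n) (d : 'cV[R]_n).
Implicit Types (lam : nat -> 'cV[R]_n) (mom : 'I_k -> 'cV[R]_n).

Notation prop r F := (propagator (t r) (X r) F).

Lemma within_piece (V : normedModType R) (F : R -> V) r : (r < m)%N ->
  {within `[0, T], continuous F} -> {within `[t r, t r.+1], continuous F}.
Proof.
move=> rm cF; apply: within_continuous_subitv cF _ _.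
  by rewrite -t0; apply: (partition_le t_incr) => //; exact: ltnW.
by rewrite -tm; apply: (partition_le t_incr).
Qed.

Definition kernel_int r (p : 'I_k) : 'M[R]_n := mxint (t r) (t r.+1) (psi p).

Definition piece_int q r (p : 'I_k) (F : R -> 'M[R]_(n, q)) : 'M[R]_(n, q) :=
  mxint (t r) (t r.+1) (fun s => psi p s *m prop r F s).

Lemma GblockE p l :
  Gblock m t phi psi X p l = \sum_(r < m) piece_int r p (phi l).
Proof. by []. Qed.

Lemma VmxE p r : Vmx m t A phi psi X p r = piece_int r p A
  + \sum_(s < m) \sum_(j < k) piece_int s p (phi j) *m kernel_int r j.
Proof. by []. Qed.

Definition const_moment lam (j : 'I_k) : 'cV[R]_n :=
  \sum_(r < m) kernel_int r j *m lam r.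

Definition source_moment f (p : 'I_k) : 'cV[R]_n := \sum_(r < m) piece_int r p f.

(* The right-hand side V lam + g of the system with matrix I - G. *)
Definition moment_rhs lam f (p : 'I_k) : 'cV[R]_n :=
  \sum_(r < m) Vmx m t A phi psi X p r *m lam r + source_moment f p.

(* The unknown of that system is the moment of x minus that of the step function
   with values lam; the second summand adds the latter back. *)
Definition moment lam f (j : 'I_k) : 'cV[R]_n :=
  \sum_(p < k) Mblock m t phi psi X j p *m moment_rhs lam f p + const_moment lam j.

(* The part of x(t r.+1) that does not depend on lam. *)
Definition defect f r : 'cV[R]_n :=
  \sum_(j < k) prop r (phi j) (t r.+1)
    *m (\sum_(p < k) Mblock m t phi psi X j p *m source_moment f p)
  + prop r f (t r.+1).

(** Whatever in the right-end value of a piece is independent of [lam] is moved to the right. Row 0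
    involves the last piece, through [x(T)]; row [p > 0] involves piece [p.-1], which ends at
    [t p]. *)
Definition Qrhs f d (p : nat) : 'cV[R]_n :=
  if p == 0%N then d - B m *m defect f m.-1 else - defect f p.-1.

(** The double sum in [Vmx] is G composed with the kernel integrals; exchanging the sums makes G act
    on the moments of the step function. *)
Lemma Vmx_sumE lam p :
  \sum_(r < m) Vmx m t A phi psi X p r *m lam r =
  \sum_(r < m) piece_int r p A *m lam r
  + \sum_(j < k) Gblock m t phi psi X p j *m const_moment lam j.
Proof.
under eq_bigr do rewrite VmxE mulmxDl; rewrite big_split/=; congr (_ + _).
under [RHS]eq_bigr do rewrite GblockE mulmx_suml.
rewrite [RHS]exchange_big/=.
under eq_bigr do rewrite mulmx_suml; rewrite exchange_big/=; apply: eq_bigr => s _.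
under eq_bigr do rewrite mulmx_suml; rewrite exchange_big/=; apply: eq_bigr => j _.
by rewrite mulmx_sumr; apply: eq_bigr => r _; rewrite mulmxA.
Qed.

Lemma IG_mxcol (v : 'I_k -> 'cV[R]_n) :
  IG m t phi psi X *m (\mxcol_p v p)
  = \mxcol_p (v p - \sum_j Gblock m t phi psi X p j *m v j).
Proof. by rewrite mulmxBl mul1mx mul_mxblock_mxcol mxcolB. Qed.

Lemma invmx_IG_mxcol (v : 'I_k -> 'cV[R]_n) :
  invmx (IG m t phi psi X) *m (\mxcol_p v p)
  = \mxcol_j \sum_p Mblock m t phi psi X j p *m v p.
Proof.
by rewrite -[invmx _]submxblockK mul_mxblock_mxcol.
Qed.

Lemma mxcol_inj (p : nat) (u v : 'I_p -> 'cV[R]_n) :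
  \mxcol_i u i = \mxcol_i v i -> forall i, u i = v i.
Proof. by move=> /eq_mxcolP. Qed.

(** Subtracting the moments of the step function gives a system with matrix I - G, solved by its
    inverse. The forward direction identifies the moments of a given solution; the backward one
    certifies the moments prescribed in the construction of a solution. *)
Lemma momentP lam f mom :
  (forall p, mom p = \sum_(r < m) (kernel_int r p *m lam r + piece_int r p A *m lam r)
     + \sum_j Gblock m t phi psi X p j *m mom j + source_moment f p)
  <-> (forall p, mom p = moment lam f p).
Proof.
pose nu p : 'cV[R]_n := mom p - const_moment lam p.
have E p : (mom p = \sum_(r < m) (kernel_int r p *m lam r + piece_int r p A *m lam r)
     + \sum_j Gblock m t phi psi X p j *m mom j + source_moment f p)
  <-> nu p - \sum_j Gblock m t phi psi X p j *m nu j = moment_rhs lam f p.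
  rewrite /moment_rhs Vmx_sumE.
  under [X in nu p - X]eq_bigr do rewrite mulmxBr.
  rewrite sumrB big_split/= -/(const_moment lam p) /nu.
  exact: eq_sub_balance.
split=> H p.
  have HI : IG m t phi psi X *m (\mxcol_p nu p) = \mxcol_p moment_rhs lam f p.
    by rewrite IG_mxcol; apply: eq_mxcol => i; exact/E.
  have := invmx_IG_mxcol (moment_rhs lam f).
  rewrite -HI mulKmx// => /mxcol_inj/(_ p); rewrite /nu /moment => <-.
  by rewrite subrK.
apply/E; move: p; apply: mxcol_inj; rewrite -IG_mxcol.
rewrite (_ : \mxcol_p nu p = invmx (IG m t phi psi X) *m \mxcol_p moment_rhs lam f p).
  by rewrite mulKVmx.
by rewrite invmx_IG_mxcol; apply: eq_mxcol => p; rewrite /nu H /moment addrK.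
Qed.

(** Inserting the solved moments into the variation of constants formula at the right end of a piece
    leaves an affine function of [lam]: [Dmx] collects its coefficients and [defect] is its constant
    term. *)
Lemma Dmx_sumE lam f r : (r < m)%N ->
  prop r A (t r.+1) *m lam r + \sum_j prop r (phi j) (t r.+1) *m moment lam f j
    + prop r f (t r.+1)
  = \sum_(i < m) Dmx m t A phi psi X r i *m lam i + defect f r.
Proof.
move=> rm; rewrite /defect addrA; congr (_ + _).
under [in RHS]eq_bigr do rewrite /Dmx mulmxDl.
rewrite [in RHS]big_split/= [RHS]addrAC [RHS]addrC.
have -> : \sum_(i < m) (if r == i then propagate t X r A (t r.+1) else 0) *m lam i
    = prop r A (t r.+1) *m lam r.
  rewrite -(sum_delta_mulmx _ _ rm); apply: eq_bigr => i _.
  by rewrite eq_sym.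
congr (_ + _).
under [X in _ = X + _]eq_bigr do rewrite mulmx_suml.
rewrite exchange_big/= -big_split/=; apply: eq_bigr => j _.
(* The coefficient of [lam i] in the moment is the bracket in the definition of [Dmx]. *)
have -> : moment lam f j =
    \sum_(i < m) (\sum_(p < k) Mblock m t phi psi X j p *m Vmx m t A phi psi X p i
      + mxint (t i) (t i.+1) (psi j)) *m lam i
    + \sum_(p < k) Mblock m t phi psi X j p *m source_moment f p.
  rewrite /moment /moment_rhs.
  under eq_bigr do rewrite mulmxDr.
  rewrite big_split/= -addrA [X in _ + X]addrC addrA; congr (_ + _).
  under [RHS]eq_bigr do rewrite mulmxDl.
  rewrite big_split/=; congr (_ + _).
  under [RHS]eq_bigr do rewrite mulmx_suml.
  rewrite [RHS]exchange_big/=; apply: eq_bigr => p _.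
  by rewrite mulmx_sumr; apply: eq_bigr => i _; rewrite mulmxA.
rewrite mulmxDr; congr (_ + _).
by rewrite mulmx_sumr; apply: eq_bigr => i _; rewrite mulmxA.
Qed.

Lemma Qblock_sum0 lam :
  \sum_(i < m) Qblock m t A phi psi B X 0 i *m lam i
  = \sum_(i < m) B i *m lam i
    + B m *m (lam m.-1 + \sum_(i < m) Dmx m t A phi psi X m.-1 i *m lam i).
Proof.
have mm : (m.-1 < m)%N by rewrite prednK.
rewrite mulmxDr -(sum_delta_mulmx (B m) lam mm) mulmx_sumr -!big_split/=.
apply: eq_bigr => i _; rewrite /Qblock/=; case: eqP => [->|_].
  by rewrite mulmxDl (mulmxDl (B _)) mulmxA addrA.
by rewrite mulmxDl mul0mx add0r mulmxA.
Qed.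

Lemma Qblock_sumS lam p : (p.+1 < m)%N ->
  \sum_(i < m) Qblock m t A phi psi B X p.+1 i *m lam i
  = lam p + \sum_(i < m) Dmx m t A phi psi X p i *m lam i - lam p.+1.
Proof.
move=> pm; rewrite -[lam p]mul1mx -[lam p.+1]mul1mx.
rewrite -(sum_delta_mulmx 1%:M lam pm) -(sum_delta_mulmx 1%:M lam (ltnW pm)).
rewrite -sumrN -!big_split/=.
apply: eq_bigr => i _; rewrite /Qblock/=; case: eqP => [->|_].
  by rewrite (ltn_eqF (ltnSn p)) mul0mx subr0 mulmxDl.
case: eqP => [->|_]; last by rewrite !mul0mx add0r subr0.
by rewrite mul0mx add0r mulNmx mulmxBl opprB.
Qed.

(** The sum of [lam p], the [Dmx] terms and [defect f p] is the value reached at the right end of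
    piece [p]. Row 0 uses it in place of [x(T)], and the other rows equate it with the next node
    value. *)
Lemma Qstar_mxcol lam f d :
  Qstar m t A phi psi B X *m (\mxcol_(i < m) lam i) = \mxcol_(p < m) Qrhs f d p
  <-> (\sum_(i < m) B i *m lam i
       + B m *m (lam m.-1 + \sum_(i < m) Dmx m t A phi psi X m.-1 i *m lam i
                 + defect f m.-1) = d)
      /\ (forall p, (p.+1 < m)%N ->
       lam p + \sum_(i < m) Dmx m t A phi psi X p i *m lam i + defect f p = lam p.+1).
Proof.
rewrite mul_mxblock_mxcol; split=> [H|[H0 HS]].
  split=> [|p pm].
    have := mxcol_inj H (Ordinal m_gt0); rewrite Qblock_sum0 /Qrhs/= => E.
    by rewrite mulmxDr addrA E subrK.
  have := mxcol_inj H (Ordinal pm); rewrite Qblock_sumS// /Qrhs/= => E.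
  apply/eqP; rewrite -subr_eq0 addrAC E addNr//.
apply: eq_mxcol => -[[|p] pm]; rewrite /Qrhs/=.
  by rewrite Qblock_sum0 -H0 (mulmxDr _ _ (defect f _)) addrA addrK.
by rewrite Qblock_sumS// -HS// opprD addrA subrr sub0r.
Qed.

(** The forcing term once the moments are frozen: the integral equation becomes an instance of
    [linear_ode]. *)
Definition drive f mom (s : R) : 'cV[R]_n := \sum_(j < k) phi j s *m mom j + f s.

Lemma drive_continuous f mom : {within `[0, T], continuous f} ->
  {within `[0, T], continuous (drive f mom)}.
Proof.
move=> cf s; apply: cvgD; last exact: cf.
apply: (continuous_sum (S := subspace `[0, T])) => j _.
by apply: continuous_mulmxr; exact: cphi.
Qed.

Lemma prop_sumE f mom (x : 'cV[R]_n) r s :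
  {within `[0, T], continuous f} -> (r < m)%N -> s \in `[t r, t r.+1] ->
  prop r (fun y => A y *m x + drive f mom y) s
  = prop r A s *m x + \sum_j prop r (phi j) s *m mom j + prop r f s.
Proof.
move=> cf rm sr; have fX := fundX rm.
have cc (C : R -> 'M[R]_n) (v : 'cV[R]_n) : {within `[0, T], continuous C} ->
    {within `[t r, t r.+1], continuous (fun y => C y *m v)}.
  move=> cC; apply: (within_piece rm); exact: continuous_mulmxr.
have cD := within_piece rm (drive_continuous (mom := mom) cf).
rewrite (propagatorD fX (cc _ _ cA) cD sr).
rewrite (propagator_mulmxr fX _ (within_piece rm cA) sr) -addrA; congr (_ + _).
have cs : {within `[t r, t r.+1], continuous (fun y => \sum_(j < k) phi j y *m mom j)}.
  apply: (continuous_sum (S := subspace `[t r, t r.+1])) => j _.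
  exact: (cc _ (mom j) (@cphi j)).
rewrite (propagatorD fX cs (within_piece rm cf) sr); congr (_ + _).
rewrite (propagator_sum fX)//; last by move=> j; exact: (cc _ (mom j) (@cphi j)).
apply: eq_bigr => j _.
exact: (propagator_mulmxr fX _ (within_piece rm (@cphi j)) sr).
Qed.

(** The shifted function [y - y (t r)] vanishes at the left node and solves the equation with
    forcing [A y(t r) + drive], so [propagatorE] applies to it. *)
Lemma linear_ode_piece f mom (y : R -> 'cV[R]_n) r s :
  {within `[0, T], continuous f} -> linear_ode A 0 T (drive f mom) y ->
  (r < m)%N -> s \in `[t r, t r.+1] ->
  y s = y (t r) + (prop r A s *m y (t r) + \sum_j prop r (phi j) s *m mom j
                   + prop r f s).
Proof.
move=> cf oy rm sr; have fX := fundX rm.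
rewrite -(prop_sumE mom _ cf rm sr).
have r0 : 0 <= t r.
  by rewrite -t0; apply: (partition_le t_incr) => //; exact: ltnW.
have rT : t r.+1 <= T by rewrite -tm; apply: (partition_le t_incr).
have [cy dy] := linear_ode_subitv r0 rT oy.
have cAr := within_piece rm cA.
rewrite -(@propagatorE _ _ A _ _ _ fX _ (fun s => y s - y (t r)) cAr _ _ _ s sr).
- by rewrite addrC subrK.
- move=> z; apply: cvgD; last exact: (within_piece rm (drive_continuous (mom := mom) cf)).
  exact: continuous_mulmxr.
- split; first by move=> z; apply: cvgB; [exact: cy|exact: cvg_cst].
  move=> z zr.
  have dc : is_derive z 1 (cst (y (t r)) : R -> 'cV[R]_n) 0 by exact: is_derive_cst.
  have -> : A z *m (y z - y (t r)) + (A z *m y (t r) + drive f mom z)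
      = A z *m y z + drive f mom z.
    by rewrite mulmxBr addrA subrK.
  by have := is_deriveB (dy _ zr) dc; rewrite subr0.
- by rewrite subrr.
Qed.

Lemma piece_int_continuous (q : nat) (F : R -> 'M[R]_(n, q)) r p : (r < m)%N ->
  {within `[0, T], continuous F} ->
  {within `[t r, t r.+1], continuous (fun s => psi p s *m prop r F s)}.
Proof.
move=> rm cF; apply: continuous_mulmx; first exact: within_piece.
exact: (propagator_continuous (fundX rm) (ltW (t_incr rm)) (within_piece rm cF)).
Qed.

Lemma piece_int_sumE f mom (x : 'cV[R]_n) r p :
  {within `[0, T], continuous f} -> (r < m)%N ->
  piece_int r p (fun y => A y *m x + drive f mom y)
  = piece_int r p A *m x + \sum_j piece_int r p (phi j) *m mom j + piece_int r p f.
Proof.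
move=> cf rm.
have c1 := piece_int_continuous (p := p) rm cA.
have c2 j := piece_int_continuous (p := p) rm (@cphi j).
have c3 := piece_int_continuous (p := p) rm cf.
have cr (C : R -> 'M[R]_n) (v : 'cV[R]_n) :
    {within `[t r, t r.+1], continuous C} ->
    {within `[t r, t r.+1], continuous (fun s => C s *m v)}.
  by move=> cC; exact: continuous_mulmxr.
have cS : {within `[t r, t r.+1], continuous
    (fun s => \sum_j (psi p s *m prop r (phi j) s) *m mom j)}.
  apply: (continuous_sum (S := subspace `[t r, t r.+1])) => j _.
  exact: (cr _ (mom j) (c2 j)).
have c1' := cr _ x c1.
have c12 : {within `[t r, t r.+1], continuous (fun s =>
    (psi p s *m prop r A s) *m x
    + \sum_j (psi p s *m prop r (phi j) s) *m mom j)}.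
  by move=> s; apply: cvgD; [exact: c1'|exact: cS].
transitivity (mxint (t r) (t r.+1) (fun s => (psi p s *m prop r A s) *m x
    + \sum_j (psi p s *m prop r (phi j) s) *m mom j + psi p s *m prop r f s)).
  apply: eq_mxint => s sr; rewrite (prop_sumE mom x cf rm sr).
  rewrite !mulmxDr mulmx_sumr mulmxA; congr (_ + _ + _).
  by apply: eq_bigr => j _; rewrite mulmxA.
rewrite (mxintD c12 c3) (mxintD c1' cS) (mxint_mulmxr _ c1) mxint_sum; last first.
  by move=> j _; exact: (cr _ (mom j) (c2 j)).
congr (_ + _ + _); apply: eq_bigr => j _.
by rewrite (mxint_mulmxr _ (c2 j)).
Qed.

Lemma piece_int_gather f mom lam p : {within `[0, T], continuous f} ->
  \sum_(r < m) piece_int r p (fun y => A y *m lam r + drive f mom y)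
  = \sum_(r < m) piece_int r p A *m lam r
    + \sum_j Gblock m t phi psi X p j *m mom j + source_moment f p.
Proof.
move=> cf; have -> : \sum_j Gblock m t phi psi X p j *m mom j
    = \sum_(r < m) \sum_j piece_int r p (phi j) *m mom j.
  by rewrite exchange_big/=; apply: eq_bigr => j _; rewrite GblockE mulmx_suml.
rewrite /source_moment -!big_split/=; apply: eq_bigr => r _.
exact: piece_int_sumE.
Qed.

(** The moments [mom] that drive [y] are kept apart from the moments of [y] computed here. Requiring
    the two to coincide is the system of [momentP]. *)
Lemma kernel_moment f mom (y : R -> 'cV[R]_n) p :
  {within `[0, T], continuous f} -> linear_ode A 0 T (drive f mom) y ->
  mxint 0 T (fun s => psi p s *m y s) =
  \sum_(r < m) (kernel_int r p *m y (t r) + piece_int r p A *m y (t r))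
     + \sum_j Gblock m t phi psi X p j *m mom j + source_moment f p.
Proof.
move=> cf oy; have [cy _] := oy.
rewrite big_split/= -!addrA [X in _ + X]addrA.
rewrite -(piece_int_gather mom (fun r => y (t r)) p cf) -big_split/=.
rewrite -t0 -tm mxint_partition ?t0 ?tm//; last first.
  by apply: continuous_mulmx; [exact: cpsi|exact: cy].
apply: eq_bigr => -[r rm] _ /=.
have cp := within_piece rm (@cpsi p).
have cH : {within `[0, T], continuous (fun s => A s *m y (t r) + drive f mom s)}.
  move=> s; apply: cvgD; last exact: drive_continuous.
  exact: continuous_mulmxr.
rewrite -(mxint_mulmxr _ cp) -mxintD.
- apply: eq_mxint => s sr; rewrite (linear_ode_piece cf oy rm sr).
  by rewrite -(prop_sumE mom _ cf rm sr) mulmxDr.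
- exact: continuous_mulmxr.
- exact: piece_int_continuous rm cH.
Qed.

Lemma solution_linear_ode f d y : is_solution m T t A phi psi B f d y ->
  linear_ode A 0 T (drive f (fun j => mxint 0 T (fun s => psi j s *m y s))) y.
Proof.
move=> [cy dy _ yE _]; split=> // s sT.
have := derivableP (dy _ sT); rewrite -derive1E yE//.
rewrite -addrA /drive; under eq_bigr => j _.
  rewrite (_ : mxint 0 T _ = phi j s *m mxint 0 T (fun tau => psi j tau *m y tau)).
    over.
  rewrite -mxint_mulmxl; last first.
    by apply: continuous_mulmx; [exact: cpsi|exact: cy].
  by apply: eq_mxint => tau _; rewrite mulmxA.
by [].
Qed.

Lemma solution_moment f d y : {within `[0, T], continuous f} ->
  is_solution m T t A phi psi B f d y ->
  forall j, mxint 0 T (fun s => psi j s *m y s) = moment (fun r => y (t r)) f j.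
Proof.
move=> cf sy; have oy := solution_linear_ode sy.
by apply/momentP => p; exact: kernel_moment.
Qed.

(** The value of [y] is matched with [lam] at one node only, although the driving moments use all of
    [lam]; this allows an induction over the nodes when a solution is constructed. *)
Lemma linear_ode_moment_step f lam (y : R -> 'cV[R]_n) r :
  {within `[0, T], continuous f} ->
  linear_ode A 0 T (drive f (moment lam f)) y -> (r < m)%N -> y (t r) = lam r ->
  y (t r.+1) = lam r + \sum_(i < m) Dmx m t A phi psi X r i *m lam i + defect f r.
Proof.
move=> cf oy rm yr.
have tr : t r.+1 \in `[t r, t r.+1] by rewrite in_itv/= lexx ltW// t_incr.
by rewrite (linear_ode_piece cf oy rm tr) yr Dmx_sumE// addrA.
Qed.

Lemma solution_Qstar f d y : {within `[0, T], continuous f} ->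
  is_solution m T t A phi psi B f d y ->
  Qstar m t A phi psi B X *m (\mxcol_(i < m) y (t i)) = \mxcol_(p < m) Qrhs f d p.
Proof.
move=> cf sy; have oy := solution_linear_ode sy.
have := oy; rewrite (_ : (fun j => _) = moment (fun r => y (t r)) f); last first.
  by apply/funext; exact: solution_moment sy.
move=> oy'; have step r (rm : (r < m)%N) := linear_ode_moment_step cf oy' rm erefl.
apply/(Qstar_mxcol (fun r => y (t r))); split=> [|p pm]; last first.
  by rewrite -step// ltnW.
have [_ _ _ _ <-] := sy.
by rewrite -step ?prednK// big_nat_recr//= big_mkord.
Qed.

Lemma solution_exists f d : {within `[0, T], continuous f} ->
  exists x, is_solution m T t A phi psi B f d x.
Proof.
move=> cf.
pose w := invmx (Qstar m t A phi psi B X) *m \mxcol_(p < m) Qrhs f d p.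
(* Node values are functions on [nat]; the default 0 is taken only for [r >= m]. *)
pose lam r : 'cV[R]_n := if insub r is Some i then submxcol w i else 0.
have lamE : \mxcol_(i < m) lam i = w.
  rewrite -[RHS]submxcolK; apply: eq_mxcol => i.
  by rewrite /lam insubT//= => im; congr submxcol; exact: val_inj.
have /(Qstar_mxcol lam)[HB HS] :
    Qstar m t A phi psi B X *m (\mxcol_(i < m) lam i) = \mxcol_(p < m) Qrhs f d p.
  by rewrite lamE /w mulKVmx.
have cF := drive_continuous (mom := moment lam f) cf.
(* Only the value at 0 is imposed and each new piece continues the previous one. That the later node
   values are those of [lam] follows afterwards from the continuity rows [HS]. *)
have ex r : (r <= m)%N ->
    exists y, linear_ode A 0 (t r) (drive f (moment lam f)) y /\ y 0 = lam 0%N.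
  elim: r => [_|r IH rm].
    (* On the degenerate interval [[0, t 0]] a constant works, since the open interval is empty. *)
    exists (cst (lam 0%N)); split=> //; split; first by move=> s; exact: cvg_cst.
    by move=> s; rewrite t0 in_itv/= => /andP[/lt_trans h /h]; rewrite ltxx.
  have [y [oy y0]] := IH (ltnW rm).
  have cFr := within_piece rm cF.
  have [z [oz zr]] := fundamental_ivp (fundX rm) (y (t r)) (ltW (t_incr rm)) cFr.
  have r0 : 0 <= t r by rewrite -t0; apply: (partition_le t_incr) => //; exact: ltnW.
  have rT : t r.+1 <= T by rewrite -tm; apply: (partition_le t_incr).
  have [x [ox x0]] := linear_ode_glue r0 (ltW (t_incr rm))
    (within_continuous_subitv cA (lexx _) rT)
    (within_continuous_subitv cF (lexx _) rT) oy oz (esym zr).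
  by exists x; split=> //; rewrite x0.
have [y [oy y0]] := ex m (leqnn m); rewrite tm in oy; have [cy dy] := oy.
have yl r : (r < m)%N -> y (t r) = lam r.
  elim: r => [_|r IH rm]; first by rewrite t0.
  by rewrite (linear_ode_moment_step cf oy (ltnW rm) (IH (ltnW rm))) HS.
have yT : y (t m) = lam m.-1
    + \sum_(i < m) Dmx m t A phi psi X m.-1 i *m lam i + defect f m.-1.
  have mm : (m.-1 < m)%N by rewrite prednK.
  have := linear_ode_moment_step cf oy mm (yl _ mm).
  by rewrite prednK.
(* Consistency: the moments used to drive [y] are its actual moments, so [y] solves the original
   equation. *)
have mE p : mxint 0 T (fun s => psi p s *m y s) = moment lam f p.
  move: p; have [_ /(_ (fun=> erefl)) M] := momentP lam f (moment lam f).
  move=> p; rewrite (kernel_moment p cf oy) M; congr (_ + _ + _).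
  by apply: eq_bigr => -[r rm] _; rewrite /= yl.
have dyE s : s \in `]0, T[ -> derive1 y s = A s *m y s + drive f (moment lam f) s.
  by move=> sT; rewrite derive1E; have [_ ->] := dy _ sT.
exists y; split=> //.
- by move=> s sT; have [] := dy _ sT.
- have cH : {within `]0, T[, continuous
      (fun s => A s *m y s + drive f (moment lam f) s)}.
    have := @subset_itv_oo_cc _ R 0 T.
    move=> /continuous_subspaceW; apply.
    by move=> s; apply: cvgD; [exact: (continuous_mulmx cA cy)|exact: cF].
  apply: subspace_eq_continuous cH => s /set_mem sT.
  by rewrite /from_subspace/= dyE.
- move=> s sT; rewrite dyE// /drive addrA; congr (_ + _ + _).
  apply: eq_bigr => j _; rewrite -mE -mxint_mulmxl; last first.
    by apply: continuous_mulmx; [exact: cpsi|exact: cy].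
  by apply: eq_mxint => tau _; rewrite mulmxA.
- rewrite big_nat_recr//= big_mkord yT -HB; congr (_ + _).
  by apply: eq_bigr => -[r rm] _; rewrite /= yl.
Qed.

(** * Estimates *)

Notation mu := (@lebesgue_measure R).
Notation al := (alpha T A).
Notation om := (omega_bar m t).
Notation ph := (phi_bar m t phi).
Notation ps := (psi_bar T psi).
Notation rh := (rho m t phi psi X).
Notation ee := (expR (al * om)).

Lemma piece_itv r s : (r < m)%N -> s \in `[t r, t r.+1] -> s \in `[0, T].
Proof.
move=> rm; rewrite !in_itv/= => /andP[rs sr]; apply/andP; split.
  by apply: le_trans rs; rewrite -t0; apply: (partition_le t_incr) => //; exact: ltnW.
by apply: le_trans sr _; rewrite -tm; apply: (partition_le t_incr).
Qed.

Lemma T_ge0 : 0 <= T.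
Proof. by rewrite -t0 -tm; exact: (partition_le t_incr). Qed.

Lemma opnorm_le_alpha s : s \in `[0, T] -> opnorm (A s) <= al.
Proof.
move=> sT; apply: (ub_le_sup (within_continuous_has_ubound (continuous_opnorm cA))).
by exists s.
Qed.

Lemma alpha_ge0 : 0 <= al.
Proof.
apply: le_trans (opnorm_ge0 (A 0)) (opnorm_le_alpha _).
by rewrite in_itv/= lexx T_ge0.
Qed.

Lemma mesh_le r : (r < m)%N -> t r.+1 - t r <= om.
Proof.
by move=> rm; exact: (le_bigmax _ (fun i : 'I_m => t i.+1 - t i) (Ordinal rm)).
Qed.

Lemma omega_bar_ge0 : 0 <= om. Proof. exact: bigmax_ge_id. Qed.
Lemma phi_bar_ge0 : 0 <= ph. Proof. exact: bigmax_ge_id. Qed.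
Lemma psi_bar_ge0 : 0 <= ps. Proof. exact: bigmax_ge_id. Qed.

Lemma exp_piece_le r s : (r < m)%N -> s \in `[t r, t r.+1] ->
  expR (al * (s - t r)) <= ee.
Proof.
move=> rm; rewrite in_itv/= => /andP[rs sr]; rewrite ler_expR.
rewrite ler_wpM2l ?alpha_ge0//; apply: le_trans (mesh_le rm).
by rewrite lerD2r.
Qed.

Lemma norm1_ge f s : {within `[0, T], continuous f} -> s \in `[0, T] ->
  `|f s| <= norm1 T f.
Proof.
move=> cf sT.
have cn : {within `[0, T], continuous (fun s => `|f s|)}.
  by move=> z; apply: cvg_norm; exact: cf.
by apply: (ub_le_sup (within_continuous_has_ubound cn)); exists s.
Qed.

Lemma norm1_le f c : (forall s, s \in `[0, T] -> `|f s| <= c) -> norm1 T f <= c.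
Proof.
move=> fc; apply: ge_sup; last by move=> _ [s sT <-]; exact: fc.
by exists `|f 0|; exists 0 => //=; rewrite in_itv/= lexx T_ge0.
Qed.

Lemma norm1_ge0 f : {within `[0, T], continuous f} -> 0 <= norm1 T f.
Proof.
move=> cf; apply: le_trans (normr_ge0 (f 0)) (norm1_ge cf _).
by rewrite in_itv/= lexx T_ge0.
Qed.

Lemma rho_ge0 : 0 <= rh. Proof. exact: opnorm_ge0. Qed.

Ltac nonneg := solve [ assumption | exact: expR_ge0 | exact: phi_bar_ge0
  | exact: psi_bar_ge0 | exact: omega_bar_ge0 | exact: rho_ge0 | exact: norm1_ge0
  | exact: ler01 | apply: mulr_ge0; nonneg | apply: addr_ge0; nonneg ].

Lemma piece_ode_bound (F U : R -> 'cV[R]_n) (g : R -> R) (c : R) r s : (r < m)%N ->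
  {within `[0, T], continuous F} -> {within `[t r, t r.+1], continuous g} ->
  (forall s, s \in `[t r, t r.+1] -> `|F s| <= g s) ->
  \int[mu]_(y in `[t r, t r.+1]) g y <= c ->
  linear_ode A (t r) (t r.+1) F U -> s \in `[t r, t r.+1] ->
  `|U s| <= ee * (`|U (t r)| + c).
Proof.
move=> rm cF cg Fg gc oU sr; have := sr; rewrite in_itv/= => /andP[rs sr'].
have Aal z : z \in `[t r, t r.+1] -> opnorm (A z) <= al.
  by move=> zr; apply: opnorm_le_alpha; exact: piece_itv zr.
apply: le_trans (linear_ode_bound (within_piece rm cA) Aal alpha_ge0
  (within_piece rm cF) cg Fg oU sr) _.
have g0 z : z \in `[t r, t r.+1] -> 0 <= g z.
  by move=> /Fg; exact: le_trans.
have I0 : 0 <= \int[mu]_(y in `[t r, s]) g y.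
  apply: Rintegral_ge0 => y; rewrite /= in_itv/= => /andP[ry ys].
  by apply: g0; rewrite in_itv/= ry (le_trans ys).
apply: ler_pM; rewrite ?expR_ge0 ?addr_ge0//; first exact: exp_piece_le.
rewrite lerD2l; apply: le_trans gc.
rewrite (Rintegral_itv_cat cg rs sr') lerDl.
apply: Rintegral_ge0 => y; rewrite /= in_itv/= => /andP[sy yr].
by apply: g0; rewrite in_itv/= yr (le_trans rs).
Qed.

Lemma drive_bound f mom (c : R) s : {within `[0, T], continuous f} ->
  (forall j, `|mom j| <= c) -> s \in `[0, T] ->
  `|drive f mom s| <= (\sum_(j < k) opnorm (phi j s)) * c + norm1 T f.
Proof.
move=> cf mc sT; apply: le_trans (ler_normD _ _) _; apply: lerD; last exact: norm1_ge.
apply: le_trans (ler_norm_sum _ _ _) _; rewrite mulr_suml; apply: ler_sum => j _.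
by apply: le_trans (le_opnorm _ _) _; rewrite ler_wpM2l ?opnorm_ge0.
Qed.

(** Integrating the pointwise bound of [drive_bound] over one piece yields [phi_bar] from the
    kernels and the mesh size from the source. *)
Lemma drive_solution_bound f mom (c : R) (U : R -> 'cV[R]_n) r s : (r < m)%N ->
  {within `[0, T], continuous f} -> 0 <= c -> (forall j, `|mom j| <= c) ->
  linear_ode A (t r) (t r.+1) (drive f mom) U -> s \in `[t r, t r.+1] ->
  `|U s| <= ee * (`|U (t r)| + (ph * c + om * norm1 T f)).
Proof.
move=> rm cf c0 mc oU sr.
have cs : {within `[t r, t r.+1], continuous (fun s => \sum_(j < k) opnorm (phi j s))}.
  apply: (@continuous_sum _ (subspace `[t r, t r.+1]) R^o) => j _.
  exact: (continuous_opnorm (within_piece rm (@cphi j))).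
have cc (x : R) : {within `[t r, t r.+1], continuous (fun=> x)}.
  by move=> z; exact: cvg_cst.
have csc : {within `[t r, t r.+1], continuous
    (fun s => (\sum_(j < k) opnorm (phi j s)) * c)}.
  by move=> z; apply: cvgM; [exact: cs|exact: cc].
have cg : {within `[t r, t r.+1], continuous
    (fun s => (\sum_(j < k) opnorm (phi j s)) * c + norm1 T f)}.
  by move=> z; apply: cvgD; [exact: csc|exact: cc].
apply: (piece_ode_bound rm (drive_continuous cf) cg _ _ oU sr).
  by move=> z zr; apply: drive_bound => //; exact: piece_itv zr.
rewrite RintegralD//; [|exact: continuous_itv_integrable|exact: continuous_itv_integrable].
rewrite RintegralZr//; last exact: continuous_itv_integrable.
rewrite (Rintegral_itv_cst _ (ltW (t_incr rm))); apply: lerD; last first.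
  by rewrite mulrC ler_wpM2r ?norm1_ge0// mesh_le.
rewrite ler_wpM2r//.
exact: (le_bigmax _ (fun i : 'I_m => \int[mu]_(s in `[t i, t i.+1])
  (\sum_(j < k) opnorm (phi j s))) (Ordinal rm)).
Qed.

Lemma norm1_0 : norm1 T (fun=> 0 : 'cV[R]_n) <= 0.
Proof. by apply: norm1_le => s _; rewrite normr0. Qed.

Lemma cst0_continuous : {within `[0, T], continuous (fun=> 0 : 'cV[R]_n)}.
Proof. by move=> z; exact: cvg_cst. Qed.

(** The whole sum is one propagation, the solution with forcing [drive f mom] and zero initial
    value. Bounding it as such keeps norms of [X r] and of its inverse out of the estimate. *)
Lemma prop_drive_bound f mom (c : R) r s : (r < m)%N ->
  {within `[0, T], continuous f} -> 0 <= c -> (forall j, `|mom j| <= c) ->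
  s \in `[t r, t r.+1] ->
  `|\sum_j prop r (phi j) s *m mom j + prop r f s|
    <= ee * (ph * c + om * norm1 T f).
Proof.
move=> rm cf c0 mc sr; have fX := fundX rm.
have := prop_sumE mom 0 cf rm sr; rewrite mulmx0 add0r => <-.
have -> : (fun y => A y *m 0 + drive f mom y) = drive f mom.
  by apply/funext => y; rewrite mulmx0 add0r.
have oP := propagator_linear_ode fX (ltW (t_incr rm))
  (within_piece rm (drive_continuous (mom := mom) cf)).
have := drive_solution_bound rm cf c0 mc oP sr.
by rewrite propagator_init normr0 add0r.
Qed.

Lemma prop_A_bound (x : 'cV[R]_n) r s : (r < m)%N -> s \in `[t r, t r.+1] ->
  `|prop r A s *m x| <= (ee - 1) * `|x|.
Proof.
move=> rm sr; have fX := fundX rm; have cAr := within_piece rm cA.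
rewrite -(propagator_mulmxr fX _ cAr sr).
have cAx : {within `[t r, t r.+1], continuous (fun y => A y *m x)}.
  exact: continuous_mulmxr.
have oP := propagator_linear_ode fX (ltW (t_incr rm)) cAx.
have Aal z : z \in `[t r, t r.+1] -> opnorm (A z) <= al.
  by move=> zr; apply: opnorm_le_alpha; exact: piece_itv zr.
apply: le_trans (linear_ode_bound_const cAr Aal alpha_ge0 oP _ sr) _.
  exact: propagator_init.
by rewrite ler_wpM2r// lerD2r exp_piece_le.
Qed.

(** The integrand [h] may change from piece to piece because propagations restart at each node; the
    integrals of [psi p] still add up to one integral over [[0, T]], hence a single factor
    [psi_bar]. *)
Lemma psi_sum_bound (h : nat -> R -> 'cV[R]_n) (c : R) p : 0 <= c ->
  (forall r, (r < m)%N -> {within `[t r, t r.+1], continuous (h r)}) ->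
  (forall r s, (r < m)%N -> s \in `[t r, t r.+1] -> `|h r s| <= c) ->
  `|\sum_(r < m) mxint (t r) (t r.+1) (fun s => psi p s *m h r s)| <= ps * c.
Proof.
move=> c0 ch hc; apply: le_trans (ler_norm_sum _ _ _) _.
have cN := continuous_opnorm (@cpsi p).
apply: (@le_trans _ _ ((\int[mu]_(s in `[0, T]) opnorm (psi p s)) * c)); last first.
  rewrite ler_wpM2r//.
  exact: (le_bigmax _ (fun q => \int[mu]_(s in `[0, T]) opnorm (psi q s)) p).
have -> : \int[mu]_(s in `[0, T]) opnorm (psi p s)
    = \sum_(r < m) \int[mu]_(s in `[t r, t r.+1]) opnorm (psi p s).
  have := Rintegral_partition t_incr (f := fun s => opnorm (psi p s)) (leqnn m).
  by rewrite t0 tm; apply; exact: cN.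
rewrite mulr_suml; apply: ler_sum => -[r rm] _ /=.
have cNr := within_piece rm (F := fun s => opnorm (psi p s) : R^o) cN.
rewrite -RintegralZr//; last exact: continuous_itv_integrable.
apply: norm_mxint_le.
- apply: continuous_mulmx; [exact: (within_piece rm (@cpsi p))|exact: ch].
- by move=> z; apply: cvgM; [exact: cNr|exact: cvg_cst].
- move=> s sr; apply: le_trans (le_opnorm _ _) _.
  by rewrite ler_wpM2l ?opnorm_ge0// hc.
Qed.

(** The sum is one component of the inverse applied to the stacked vector, and a component never
    exceeds the max norm of the stack; so [rho] appears without a factor [k]. *)
Lemma Mblock_bound (w : 'I_k -> 'cV[R]_n) (c : R) j : 0 <= c ->
  (forall p, `|w p| <= c) ->
  `|\sum_p Mblock m t phi psi X j p *m w p| <= rh * c.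
Proof.
move=> c0 wc.
apply: le_trans (le_norm_mxcol (fun j => \sum_p Mblock m t phi psi X j p *m w p) j) _.
rewrite -invmx_IG_mxcol; apply: le_trans (le_opnorm _ _) _.
by rewrite ler_wpM2l ?opnorm_ge0// norm_mxcol_le.
Qed.

Lemma const_moment_bound lam (L : R) j : 0 <= L ->
  (forall r, (r < m)%N -> `|lam r| <= L) -> `|const_moment lam j| <= ps * L.
Proof.
move=> L0 lL.
have -> : const_moment lam j
    = \sum_(r < m) mxint (t r) (t r.+1) (fun s => psi j s *m lam r).
  apply: eq_bigr => -[r rm] _ /=.
  by rewrite (mxint_mulmxr _ (within_piece rm (@cpsi j))).
apply: (psi_sum_bound (h := fun r _ => lam r) j L0) => [r rm|r s rm _].
  by move=> z; exact: cvg_cst.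
exact: lL.
Qed.

Lemma source_moment_bound f p : {within `[0, T], continuous f} ->
  `|source_moment f p| <= ps * (ee * (om * norm1 T f)).
Proof.
move=> cf; apply: (psi_sum_bound (h := fun r => prop r f) p).
- nonneg.
- move=> r rm.
  exact: (propagator_continuous (fundX rm) (ltW (t_incr rm)) (within_piece rm cf)).
- move=> r s rm sr.
  have m0 (j : 'I_k) : `|(fun=> 0 : 'cV[R]_n) j| <= 0 :> R by rewrite normr0.
  have := prop_drive_bound rm cf (lexx 0) m0 sr.
  by rewrite big1 ?add0r ?mulr0 ?add0r// => j _; rewrite mulmx0.
Qed.

(** Regrouped by piece, this is the [psi p] moment of propagations forced by [A lam r] plus the
    drive of the step function's moments. The first forcing costs [ee - 1]; the second costs [ee],
    with those moments bounded by [psi_bar * L]. *)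
Lemma moment_rhs_bound lam f (L : R) p : {within `[0, T], continuous f} -> 0 <= L ->
  (forall r, (r < m)%N -> `|lam r| <= L) ->
  `|moment_rhs lam f p|
    <= ps * ((ee - 1) * L + ee * (ph * (ps * L) + om * norm1 T f)).
Proof.
move=> cf L0 lL; rewrite /moment_rhs Vmx_sumE -piece_int_gather//.
have psL : 0 <= ps * L by rewrite mulr_ge0// psi_bar_ge0.
have e1 : 0 <= ee - 1.
  by rewrite subr_ge0 -expR0 ler_expR mulr_ge0// ?alpha_ge0 ?omega_bar_ge0.
have cH r : {within `[0, T], continuous
    (fun s => A s *m lam r + drive f (const_moment lam) s)}.
  move=> s; apply: cvgD; last exact: drive_continuous.
  exact: continuous_mulmxr.
apply: (psi_sum_bound (h := fun r =>
  prop r (fun y => A y *m lam r + drive f (const_moment lam) y)) p).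
- nonneg.
- move=> r rm.
  exact: (propagator_continuous (fundX rm) (ltW (t_incr rm)) (within_piece rm (cH r))).
- move=> r s rm sr; rewrite prop_sumE// -addrA.
  apply: le_trans (ler_normD _ _) _; apply: lerD.
    by apply: le_trans (prop_A_bound _ rm sr) _; rewrite ler_wpM2l// lL.
  by apply: prop_drive_bound => // j; exact: const_moment_bound.
Qed.

Lemma moment_bound lam f (L : R) j : {within `[0, T], continuous f} -> 0 <= L ->
  (forall r, (r < m)%N -> `|lam r| <= L) ->
  `|moment lam f j|
    <= rh * (ps * ((ee - 1) * L + ee * (ph * (ps * L) + om * norm1 T f))) + ps * L.
Proof.
move=> cf L0 lL; apply: le_trans (ler_normD _ _) _.
apply: lerD; last exact: const_moment_bound.
apply: Mblock_bound => [|p]; last exact: moment_rhs_bound.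
have e1 : 0 <= ee - 1.
  by rewrite subr_ge0 -expR0 ler_expR mulr_ge0// ?alpha_ge0 ?omega_bar_ge0.
nonneg.
Qed.

Lemma defect_bound f r : {within `[0, T], continuous f} -> (r < m)%N ->
  `|defect f r|
    <= ee * (ph * (rh * (ps * (ee * (om * norm1 T f)))) + om * norm1 T f).
Proof.
move=> cf rm.
have g0 : 0 <= ps * (ee * (om * norm1 T f)).
  nonneg.
(* [defect] is a propagation driven by the moments that belong to [lam = 0], themselves bounded
   through [rho]. *)
apply: prop_drive_bound => //.
- by rewrite mulr_ge0// rho_ge0.
- by move=> j; apply: Mblock_bound => // p; exact: source_moment_bound.
- by rewrite in_itv/= lexx ltW// t_incr.
Qed.

(** Both [d] and every [defect] are at most the maximum with 1 times the size of the data. Row 0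
    combines one of each, the second multiplied by [B m], whence the factor [1 + opnorm (B m)]; the
    other rows contain a single defect. *)
Lemma Qrhs_bound f d p : {within `[0, T], continuous f} -> (p < m)%N ->
  `|Qrhs f d p| <= (1 + opnorm (B m))
     * Num.max 1 (om * ee * (1 + ee * ph * rh * ps)) * Num.max `|d| (norm1 T f).
Proof.
move=> cf pm.
set K := Num.max 1 _; set M := Num.max `|d| _; set b := opnorm (B m).
have b0 : 0 <= b by exact: opnorm_ge0.
have K1 : 1 <= K by rewrite le_max lexx.
have K0 : 0 <= K by apply: le_trans K1.
have M0 : 0 <= M by rewrite le_max normr_ge0.
have dM : `|d| <= K * M.
  by apply: (@le_trans _ _ M); [rewrite le_max lexx|rewrite ler_peMl].
have FM r : (r < m)%N -> `|defect f r| <= K * M.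
  move=> rm; apply: le_trans (defect_bound cf rm) _.
  rewrite (_ : _ * _ = om * ee * (1 + ee * ph * rh * ps) * norm1 T f); last by ring.
  apply: ler_pM; rewrite ?norm1_ge0 ?le_max ?lexx ?orbT//.
  nonneg.
rewrite -mulrA mulrDl mul1r /Qrhs; case: p pm => [|p] pm /=.
  apply: le_trans (ler_normB _ _) _; apply: lerD => //.
  apply: le_trans (le_opnorm _ _) _; rewrite ler_wpM2l// FM// prednK//.
rewrite normrN; apply: le_trans (FM _ (ltnW pm)) _.
by rewrite lerDl !mulr_ge0.
Qed.

Lemma solution_bound f d y s : {within `[0, T], continuous f} ->
  is_solution m T t A phi psi B f d y -> s \in `[0, T] ->
  `|y s| <= Nconst m T t A phi psi B X * Num.max `|d| (norm1 T f).
Proof.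
move=> cf sy sT; have oy := solution_linear_ode sy.
rewrite (_ : (fun j => _) = moment (fun r => y (t r)) f) in oy; last first.
  by apply/funext; exact: solution_moment sy.
pose M := Num.max `|d| (norm1 T f).
pose K := Num.max 1 (om * ee * (1 + ee * ph * rh * ps)).
pose b := opnorm (B m).
pose ga := gamma_star m t A phi psi B X.
pose L := ga * ((1 + b) * K * M).
have M0 : 0 <= M by rewrite le_max normr_ge0.
have K0 : 0 <= K by rewrite le_max ler01.
have b0 : 0 <= b by exact: opnorm_ge0.
have ga0 : 0 <= ga by exact: opnorm_ge0.
have R0 : 0 <= (1 + b) * K * M by rewrite !mulr_ge0// addr_ge0.
have L0 : 0 <= L by rewrite mulr_ge0.
have yL r : (r < m)%N -> `|y (t r)| <= L.
  move=> rm.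
  apply: le_trans (le_norm_mxcol (fun i : 'I_m => y (t i)) (Ordinal rm)) _.
  rewrite -(mulKmx Qunit (\mxcol_(i < m) y (t i))) (solution_Qstar cf sy).
  apply: le_trans (le_opnorm _ _) _; rewrite ler_wpM2l//.
  by apply: norm_mxcol_le => // i; exact: Qrhs_bound.
have mB j := moment_bound j cf L0 yL.
have e1 : 0 <= ee - 1.
  by rewrite subr_ge0 -expR0 ler_expR mulr_ge0// ?alpha_ge0 ?omega_bar_ge0.
have N0 := norm1_ge0 cf.
have sm : s \in `[t 0%N, t m] by rewrite t0 tm.
have mm : (0 < m <= m)%N by rewrite m_gt0 leqnn.
have [r rm sr] := partition_cover t_incr mm sm.
have r0 : 0 <= t r.
  by rewrite -t0; apply: (partition_le t_incr) => //; exact: ltnW.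
have rT : t r.+1 <= T by rewrite -tm; apply: (partition_le t_incr).
have c0 : 0 <= rh * (ps * ((ee - 1) * L + ee * (ph * (ps * L) + om * norm1 T f)))
    + ps * L.
  nonneg.
apply: le_trans (drive_solution_bound rm cf c0 mB (linear_ode_subitv r0 rT oy) sr) _.
(* The bound is sorted into a multiple of the node bound [L] and a multiple of [norm1 T f]; they
   become the two summands of [Nconst] once [norm1 T f] is enlarged to [M]. *)
apply: (@le_trans _ _ (ee * (ph * (rh * ps * (ee - 1 + ee * ph * ps) + ps) + 1) * L
   + ee * om * (ph * rh * ps * ee + 1) * norm1 T f)).
  rewrite [leRHS](_ : _ = ee * (L + (ph * (rh * (ps * ((ee - 1) * L
    + ee * (ph * (ps * L) + om * norm1 T f))) + ps * L) + om * norm1 T f))); last by ring.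
  by rewrite ler_wpM2l ?expR_ge0// lerD2r yL.
rewrite [leRHS](_ : _ = ee * (ph * (rh * ps * (ee - 1 + ee * ph * ps) + ps) + 1) * L
   + ee * om * (ph * rh * ps * ee + 1) * M); last by rewrite /Nconst /L /M /K /b /ga; ring.
rewrite lerD2l ler_wpM2l//.
  nonneg.
by rewrite le_max lexx orbT.
Qed.

(** * Uniqueness by linearity, and the final assembly *)

Lemma is_solutionB f g d e x y : is_solution m T t A phi psi B f d x ->
  is_solution m T t A phi psi B g e y ->
  is_solution m T t A phi psi B (fun s => f s - g s) (d - e) (fun s => x s - y s).
Proof.
move=> [cx dx cx' xE xd] [cy dy cy' yE yd].
have dE s : s \in `]0, T[ -> derive1 (fun s => x s - y s) s = derive1 x s - derive1 y s.
  move=> sT; rewrite !derive1E.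
  have := is_deriveB (derivableP (dx _ sT)) (derivableP (dy _ sT)).
  by move=> [_ <-].
split.
- by move=> s; apply: cvgB; [exact: cx|exact: cy].
- move=> s sT; have := is_deriveB (derivableP (dx _ sT)) (derivableP (dy _ sT)).
  by case.
- have cB : {within `]0, T[, continuous (fun s => derive1 x s - derive1 y s)}.
    by move=> s; apply: cvgB; [exact: cx'|exact: cy'].
  apply: subspace_eq_continuous cB => s /set_mem sT.
  by rewrite /from_subspace/= dE.
- move=> s sT; rewrite dE// xE// yE//.
  have -> : \sum_(j < k) mxint 0 T (fun tau => phi j s *m psi j tau *m (x tau - y tau))
      = \sum_(j < k) mxint 0 T (fun tau => phi j s *m psi j tau *m x tau)
        - \sum_(j < k) mxint 0 T (fun tau => phi j s *m psi j tau *m y tau).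
    rewrite -sumrB; apply: eq_bigr => j _.
    have cc : {within `[0, T], continuous (fun tau => phi j s *m psi j tau)}.
      by apply: continuous_mulmx; [move=> ?; exact: cvg_cst|exact: cpsi].
    have c1 := continuous_mulmx cc cx; have c2 := continuous_mulmx cc cy.
    rewrite -(mxintN c2) -(mxintD c1).
      by apply: eq_mxint => tau _; rewrite mulmxBr.
    by move=> z; apply: cvgN; exact: c2.
  by rewrite mulmxBr -!addrA; congr (_ + _); rewrite !opprD !addrA; apply/matrixP
    => a b; rewrite !mxE; ring.
- by rewrite -xd -yd -sumrB; apply: eq_bigr => i _; rewrite mulmxBr.
Qed.

Lemma solution_unique f d x y s : is_solution m T t A phi psi B f d x ->
  is_solution m T t A phi psi B f d y -> s \in `[0, T] -> y s = x s.
Proof.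
move=> sx sy sT; have := is_solutionB sy sx; rewrite subrr.
rewrite (_ : (fun s => f s - f s) = (fun=> 0)); last first.
  by apply/funext => z; rewrite subrr.
move=> sB; have := solution_bound cst0_continuous sB sT.
rewrite normr0 max_l ?norm1_0// mulr0 normr_le0 subr_eq0.
by move/eqP.
Qed.

End Reduction.

Theorem theorem2p1 (R : realType) (n k m : nat) (T : R) (t : nat -> R)
    (A : R -> 'M[R]_n) (phi psi : 'I_k -> R -> 'M[R]_n)
    (B : nat -> 'M[R]_n) (X : nat -> R -> 'M[R]_n)
    (n_gt0 : (0 < n)%N) (k_gt0 : (0 < k)%N) (m_gt0 : (0 < m)%N)
    (T_gt0 : 0 < T) (t0 : t 0%N = 0) (tm : t m = T)
    (t_incr : forall r : nat, (r < m)%N -> t r < t r.+1)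
    (cA : {within `[0, T], continuous A})
    (cphi : forall j : 'I_k, {within `[0, T], continuous (phi j)})
    (cpsi : forall j : 'I_k, {within `[0, T], continuous (psi j)})
    (fundX : forall r : nat, (r < m)%N ->
       fundamental_matrix A (t r) (t r.+1) (X r))
    (regular : IG m t phi psi X \in unitmx)
    (Qunit : Qstar m t A phi psi B X \in unitmx) :
  forall (f : R -> 'cV[R]_n) (d : 'cV[R]_n),
    {within `[0, T], continuous f} ->
    exists x : R -> 'cV[R]_n,
      [/\ is_solution m T t A phi psi B f d x,
          forall y : R -> 'cV[R]_n, is_solution m T t A phi psi B f d y ->
            forall s : R, s \in `[0, T] -> y s = x s
        & norm1 T x <= Nconst m T t A phi psi B X * Num.max `|d| (norm1 T f)].
Proof.
move=> f d cf.
have [x sx] := solution_exists m_gt0 t0 tm t_incr cA cphi cpsi fundX regular Qunit d cf.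
exists x; split=> //.
  move=> y sy s sT.
  exact: (solution_unique m_gt0 t0 tm t_incr cA cphi cpsi fundX regular Qunit sx sy sT).
apply: (norm1_le t0 tm t_incr) => s sT.
exact: (solution_bound m_gt0 t0 tm t_incr cA cphi cpsi fundX regular Qunit cf sx sT).
Qed.
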